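(* Let $n\ge1$ and $R\in\mathcal C_n^*$. Then the quotient graph $Q_R$ is regular if and only if the reduced arc diagram of $R$ is simple, i.e., every maximal element of $F_R$ is a simple fence. In that case $Q_R$ is $(n-1)$-regular.
   Context: $S_n$ is the set of permutations of $[n]$ with the weak order (inclusion of inversion sets); a lattice congruence is an equivalence relation compatible with joins and meets. Fences. $]a,b[=\{a+1,\dots,b-1\}$. For $1\le a<b\le n$ and $L\subseteq\,]a,b[$, the fence $f(a,b,L)$ is the set of cover edges joining permutations that differ by swapping adjacent entries $a,b$, with the values of $L$ left of $a,b$ and those of $]a,b[\setminus L$ to the right. Forcing order: $f(a,b,L)\prec f(c,d,M)$ iff $a\le c<d\le b$, $(a,b)\ne(c,d)$, $M=L\cap\,]c,d[$. Reading's theorem. Lattice congruences $R$ correspond bijectively to downsets $F_R$ of the forcing order (a cover edge joins equivalent permutations iff it lies in a fence of $F_R$). $R$ is essential if $F_R$ contains no $f(a,a+1,\emptyset)$; $\mathcal C_n^*$ is the set of essential congruences. The reduced arc diagram of $R$ is the set of maximal elements of $F_R$. A fence $f(a,b,L)$ is simple if $b-a\ge2$ and $L=\emptyset$ or $L=\,]a,b[$. $Q_R$ is the undirected cover graph of $S_n/R$. *)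

(* Defs.v *)
From mathcomp Require Import all_boot fingroup perm.
Set Implicit Arguments. Unset Strict Implicit. Unset Printing Implicit Defensive.

(* Conventions: [n] = {1,...,n} is represented by 'I_n, the value k+1 being
   encoded by k : 'I_n.  A permutation w : {perm 'I_n} is the word
   w(0) w(1) ... w(n-1), i.e. w maps positions to values; w^-1 maps a value to
   its position. *)

Section Weak.
Variable n : nat.
Notation perm_n := {perm 'I_n}.

Definition inv_set (w : perm_n) : {set 'I_n * 'I_n} :=
  [set p : 'I_n * 'I_n | (p.1 < p.2) && ((w^-1)%g p.2 < (w^-1)%g p.1)].

Definition wle (u w : perm_n) : bool := inv_set u \subset inv_set w.

Definition is_join (x y j : perm_n) : Prop :=
  wle x j /\ wle y j /\ forall z, wle x z -> wle y z -> wle j z.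
Definition is_meet (x y m : perm_n) : Prop :=
  wle m x /\ wle m y /\ forall z, wle z x -> wle z y -> wle z m.

Definition lattice_congruence (R : rel perm_n) : Prop :=
  equivalence_rel R /\
  (forall x y z j1 j2, R x y -> is_join x z j1 -> is_join y z j2 -> R j1 j2) /\
  (forall x y z m1 m2, R x y -> is_meet x z m1 -> is_meet y z m2 -> R m1 m2).

Definition oint (a b : 'I_n) : {set 'I_n} := [set c : 'I_n | (a < c) && (c < b)].

Definition fence := ('I_n * 'I_n * {set 'I_n})%type.
Definition fa (f : fence) := f.1.1.
Definition fb (f : fence) := f.1.2.
Definition fL (f : fence) := f.2.

Definition is_fence (f : fence) : bool :=
  (fa f < fb f) && (fL f \subset oint (fa f) (fb f)).

(* (u,w) is a cover edge of the fence f(a,b,L): u has a,b at adjacent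
   positions i,i+1, w is u with these two entries swapped, and the values of
   L (resp. ]a,b[ \ L) lie to the left (resp. right) of a,b. *)
Definition fence_edge (f : fence) (u w : perm_n) : Prop :=
  exists (i j : 'I_n), j = i.+1 :> nat /\
    u i = fa f /\ u j = fb f /\ w i = fb f /\ w j = fa f /\
    (forall k, k != i -> k != j -> u k = w k) /\
    (forall c, c \in oint (fa f) (fb f) -> (c \in fL f) = ((u^-1)%g c < i)).

Definition forces (f g : fence) : Prop :=
  fa f <= fa g /\ fa g < fb g /\ fb g <= fb f /\
  (fa f, fb f) <> (fa g, fb g) /\ fL g = fL f :&: oint (fa g) (fb g).

Definition inF (R : rel perm_n) (f : fence) : Prop :=
  is_fence f /\ forall u w, fence_edge f u w -> R u w.

Definition essential (R : rel perm_n) : Prop :=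
  forall a b : 'I_n, b = a.+1 :> nat -> ~ inF R (a, b, set0).

Definition in_reduced_arc_diagram (R : rel perm_n) (f : fence) : Prop :=
  inF R f /\ forall g, is_fence g -> forces f g -> ~ inF R g.

Definition simple_fence (f : fence) : Prop :=
  2 <= fb f - fa f /\ (fL f = set0 \/ fL f = oint (fa f) (fb f)).

Definition reduced_arc_diagram_simple (R : rel perm_n) : Prop :=
  forall f, in_reduced_arc_diagram R f -> simple_fence f.

Definition rclass (R : rel perm_n) (x : perm_n) : {set perm_n} :=
  [set y | R x y].
Definition qverts (R : rel perm_n) : {set {set perm_n}} :=
  [set rclass R x | x : perm_n].
Definition qle (X Y : {set perm_n}) : bool :=
  [exists x in X, exists y in Y, wle x y].
Definition qlt (X Y : {set perm_n}) : bool := (X != Y) && qle X Y.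
Definition qcover (R : rel perm_n) (X Y : {set perm_n}) : bool :=
  [&& X \in qverts R, Y \in qverts R, qlt X Y &
      [forall Z in qverts R, ~~ (qlt X Z && qlt Z Y)]].
Definition qadj (R : rel perm_n) (X Y : {set perm_n}) : bool :=
  qcover R X Y || qcover R Y X.
Definition qdeg (R : rel perm_n) (X : {set perm_n}) : nat :=
  #|[set Y in qverts R | qadj R X Y]|.

Definition Q_kregular (R : rel perm_n) (k : nat) : Prop :=
  forall X, X \in qverts R -> qdeg R X = k.
Definition Q_regular (R : rel perm_n) : Prop := exists k, Q_kregular R k.

End Weak.

(* Main.v *)
(* A class of R is an interval [x, y] of the weak order, i.e. the set of linear
   extensions of the poset P obtained by intersecting the words x and y. Its
   degree in Q_R is the number of cover relations of P. As R is essential, i and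
   i+1 are always comparable in P, so the cover graph of P is connected and has
   at least n-1 edges; the class of the identity has exactly n-1.

   If f(a,b,L) is maximal in F_R with l in L and m in ]a,b[ \ L, then a class
   containing a word ..l a b m.. of the fence has a cover graph with the cycle
   l - a - m - b, hence degree at least n.

   Conversely, assume that the maximal elements of F_R are simple. If r < r' are
   two lower covers of s in P, the edge swapping r and r' is contracted because
   of some simple arc (a,b) between r and r'; as the edges (r,s) and (s,r') are not
   contracted, this is an arc f(a,b,{}) with a < s < b, and s turns out to be
   below all of ]a,b[ in P. Hence no cover relation among the elements preceding
   s joins a value below s to a value above it, and the cover graph is a
   forest. *)
Require Import Defs.
From mathcomp Require Import all_boot fingroup perm.
From mathcomp Require Import zify.
Set Implicit Arguments. Unset Strict Implicit. Unset Printing Implicit Defensive.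

(** * Permutations as word orders, and the weak order lattice *)

Section WordOrder.
Variable n : nat.
Implicit Types (u v w x y z : {perm 'I_n}) (i j k p q : 'I_n).

Definition bef w i j : bool := (w^-1)%g i < (w^-1)%g j.
Definition adj w i j : bool :=
  bef w i j && [forall c, ~~ (bef w i c && bef w c j)].
(** Products of permutations apply the left factor first, so multiplying by [tperm p q] on the right
    exchanges the values [p] and [q], wherever they stand in the word. *)
Definition sw w p q : {perm 'I_n} := (w * tperm p q)%g.

Lemma bef_irr w i : bef w i i = false. Proof. exact: ltnn. Qed.
Lemma bef_trans w j i k : bef w i j -> bef w j k -> bef w i k.
Proof. exact: ltn_trans. Qed.
Lemma bef_asym w i j : bef w i j -> bef w j i -> False.
Proof. by move=> h /(bef_trans h); rewrite bef_irr. Qed.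
Lemma bef_total w i j : i != j -> bef w i j || bef w j i.
Proof.
by move=> ij; rewrite -neq_ltn; apply: contra ij => /eqP/val_inj/perm_inj->.
Qed.
Lemma befN w i j : i != j -> bef w j i = ~~ bef w i j.
Proof.
move=> /(bef_total w); case ij: (bef w i j) => //=.
by move=> _; apply/negP=> /(bef_asym ij).
Qed.
Lemma bef_neq w i j : bef w i j -> i != j.
Proof. by apply: contraTneq => ->; rewrite bef_irr. Qed.

(** The position of a value is the number of its predecessors, a rank that is strictly monotone and
    hence injective. Words can thus be specified by their order alone. *)
Lemma order_perm (lt : rel 'I_n) : irreflexive lt -> transitive lt ->
  (forall i j, i != j -> lt i j || lt j i) ->
  exists w, forall i j, bef w i j = lt i j.
Proof.
move=> irr tr tot.
have rk_lt i : #|[set j | lt j i]| < n.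
  rewrite -[X in _ < X]card_ord -cardsT; apply: proper_card.
  by apply/properP; split; [apply/subsetP | exists i; rewrite inE ?irr].
pose rk i := Ordinal (rk_lt i).
have rk_mono i j : lt i j -> rk i < rk j.
  move=> ij; apply: proper_card; apply/properP; split.
    by apply/subsetP=> k; rewrite !inE => /tr; apply.
  by exists i; rewrite inE ?irr.
have rk_inj : injective rk.
  move=> i j eij; apply/eqP/negPn/negP => /tot/orP[] /rk_mono;
  by rewrite eij ltnn.
exists ((perm rk_inj)^-1)%g => i j; rewrite /bef invgK !permE.
case: (eqVneq i j) => [->|/tot/orP[h|h]]; rewrite ?ltnn ?irr //.
  by rewrite h rk_mono.
rewrite ltnNge ltnW ?rk_mono //=; apply/esym/negP => /tr/(_ h).
by rewrite irr.
Qed.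

(** A stable sort: blocks follow [cls], and each block keeps the order of [w]. Most explicit words
    below are built in this way. *)
Lemma reorder (cls : 'I_n -> nat) w : exists w', forall i j,
  bef w' i j = (cls i < cls j) || (cls i == cls j) && bef w i j.
Proof.
apply: order_perm => [i|j i k|i j /(bef_total w)].
- by rewrite bef_irr andbF ltnn.
- move=> /orP[h|/andP[/eqP e h]] /orP[h'|/andP[/eqP e' h']].
  + by rewrite (ltn_trans h h').
  + by rewrite -e' h.
  + by rewrite e h'.
  + by rewrite e e' eqxx (bef_trans h h') orbT.
- case: (ltngtP (cls i) (cls j)) => //=; rewrite ?orbT //.
Qed.

Lemma val_pos w i : (w^-1)%g i = #|[set j | bef w j i]| :> nat.
Proof.
have -> : [set j | bef w j i] = (w^-1)%g @^-1: [set k : 'I_n | k < (w^-1)%g i].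
  by apply/setP => j; rewrite !inE.
rewrite card_preimset; last exact: perm_inj.
have le_n : (w^-1)%g i <= n by apply: ltnW.
rewrite -sum1_card; under eq_bigl => k do rewrite inE.
by rewrite (big_ord_narrow le_n) sum1_card card_ord.
Qed.

Lemma bef_inj u w : bef u =2 bef w -> u = w.
Proof.
move=> h; apply: invg_inj; apply/permP => i; apply: val_inj; rewrite /= !val_pos.
by congr #|pred_of_set _|; apply/setP=> j; rewrite !inE h.
Qed.

Lemma inv_setE w i j : ((i, j) \in inv_set w) = (i < j) && bef w j i.
Proof. by rewrite inE. Qed.

Lemma wleP u w :
  reflect (forall i j, i < j -> bef u j i -> bef w j i) (wle u w).
Proof.
apply: (iffP subsetP) => [h i j ij uji|h [i j]].
  by have := h (i, j); rewrite !inv_setE ij uji => /(_ isT).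
by rewrite !inv_setE => /andP[ij uji]; rewrite ij /= h.
Qed.

Lemma wle_refl u : wle u u. Proof. exact: subxx. Qed.
Lemma wle_trans v u w : wle u v -> wle v w -> wle u w.
Proof. exact: subset_trans. Qed.

Lemma ltn_neq i j : i < j -> i != j.
Proof. by apply: contraTneq => ->; rewrite ltnn. Qed.

Lemma bef_bylt u w : (forall i j, i < j -> bef u i j = bef w i j) -> u = w.
Proof.
move=> h; apply: bef_inj => i j.
case: (ltngtP i j) => [|ji|/val_inj->]; [exact: h| |by rewrite !bef_irr].
by rewrite (befN _ (ltn_neq ji)) [RHS](befN _ (ltn_neq ji)) h.
Qed.

Lemma wle_anti u w : wle u w -> wle w u -> u = w.
Proof.
move=> /wleP h /wleP h'; apply: bef_bylt => i j ij.
have ji : j != i by rewrite eq_sym ltn_neq.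
rewrite (befN _ ji) [RHS](befN _ ji); congr negb.
by apply/idP/idP; [apply: h|apply: h'].
Qed.

Lemma wle_bef u w i j : wle u w -> i < j -> bef w i j -> bef u i j.
Proof.
move=> /wleP h ij; have ji : j != i by rewrite eq_sym ltn_neq.
by rewrite !(befN _ ji); apply: contra; apply: h.
Qed.

Lemma adjP w i j :
  reflect (bef w i j /\ forall c, bef w i c -> bef w c j -> False) (adj w i j).
Proof.
apply: (iffP andP) => -[h].
  by move=> /forallP h'; split=> // c hi hj; move/negP: (h' c); rewrite hi hj.
by move=> h'; split=> //; apply/forallP => c; apply/negP => /andP[]; apply: h'.
Qed.

Lemma adj_pos w i j : adj w i j = ((w^-1)%g j == ((w^-1)%g i).+1 :> nat).
Proof.
apply/adjP/eqP => [[ij h]|e]; last first.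
  by rewrite /bef e; split=> // c; rewrite ltnS => h /(leq_trans h); rewrite ltnn.
apply/eqP; rewrite eqn_leq [X in _ && X]ij andbT leqNgt; apply/negP => lt.
have lt' : ((w^-1)%g i).+1 < n by apply: ltn_trans lt (ltn_ord _).
by apply: (h (w (Ordinal lt'))); rewrite /bef permK.
Qed.

Lemma adj_out w p q c : adj w p q -> c != p -> c != q ->
  (bef w p c = bef w q c) * (bef w c p = bef w c q).
Proof.
move=> /adjP[pq h] cp cq; split; apply/idP/idP.
- move=> pc; have := bef_total w cq; case/orP => // cq'.
  by case: (h c).
- exact: bef_trans.
- by move/bef_trans; apply.
- move=> cq'; have := bef_total w cp; case/orP => // pc.
  by case: (h c).
Qed.

Lemma bef_sw w p q i j : bef (sw w p q) i j = bef w (tperm p q i) (tperm p q j).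
Proof. by rewrite /bef /sw invMg tpermV !permM. Qed.

Lemma swC w p q : sw w p q = sw w q p. Proof. by rewrite /sw tpermC. Qed.
Lemma swK w p q : sw (sw w p q) p q = w.
Proof. by rewrite /sw -mulgA tperm2 mulg1. Qed.

Lemma bef_sw_adj w p q i j : adj w p q ->
  bef (sw w p q) i j = if (i == p) && (j == q) then false
                       else if (i == q) && (j == p) then true else bef w i j.
Proof.
move=> a; have [pq _] := adjP _ _ _ a; have npq := bef_neq pq.
rewrite bef_sw; do 2![case: tpermP => [->|->|/eqP ? /eqP ?]];
  rewrite ?eqxx ?(negbTE npq) ?[q == p]eq_sym ?(negbTE npq) ?bef_irr //=;
  try (by apply/negP => /(bef_asym pq));
  rewrite ?(adj_out a) //;
  repeat match goal with h : is_true (?x != ?y) |- _ =>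
    rewrite ?(negbTE h); clear h end; by rewrite ?andbF.
Qed.

Lemma adj_sw w p q : adj w p q -> adj (sw w p q) q p.
Proof.
move=> a; have [pq _] := adjP _ _ _ a; have npq := bef_neq pq.
by move: a; rewrite !adj_pos /sw invMg tpermV !permM tpermL tpermR.
Qed.

Lemma inv_sw w p q i j : adj w p q -> p < q -> i < j ->
  bef (sw w p q) j i = ((i == p) && (j == q)) || bef w j i.
Proof.
move=> a pq ij; rewrite bef_sw_adj //.
case: ifP => [/andP[/eqP ? /eqP ?]|_]; first by subst; lia.
by rewrite andbC; case: ifP.
Qed.

Lemma wle_sw w p q : adj w p q -> p < q -> wle w (sw w p q).
Proof. by move=> a pq; apply/wleP => i j ij; rewrite inv_sw // => ->; rewrite orbT. Qed.

(** Positions disappear here: as [fa f] and [fb f] are adjacent, a value stands left of both exactly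
    when it stands left of [fa f]. *)
Lemma fence_edgeP (f : fence n) u w : is_fence f ->
  (fence_edge f u w <-> [/\ adj u (fa f) (fb f), w = sw u (fa f) (fb f) &
   forall c, c \in oint (fa f) (fb f) -> (c \in fL f) = bef u c (fa f)]).
Proof.
move=> /andP[ab _]; split.
  move=> [i [j [ji [ui [uj [wi [wj [uw pat]]]]]]]].
  have ua : (u^-1)%g (fa f) = i by rewrite -ui permK.
  have ub : (u^-1)%g (fb f) = j by rewrite -uj permK.
  split; first by rewrite adj_pos ua ub ji.
    apply/permP=> k; rewrite /sw permM.
    case: (eqVneq k i) => [->|ki]; first by rewrite ui tpermL.
    case: (eqVneq k j) => [->|kj]; first by rewrite uj tpermR.
    by rewrite tpermD -?uw // -1?ui -1?uj (inj_eq perm_inj) eq_sym.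
  by move=> c hc; rewrite /bef ua; apply: pat.
move=> [a -> pat]; exists ((u^-1)%g (fa f)), ((u^-1)%g (fb f)).
rewrite /sw !permM !permKV tpermL tpermR; do ![split] => //.
  by apply/eqP; rewrite -adj_pos.
move=> k k1 k2; rewrite permM tpermD //.
  by apply: contra k1 => /eqP->; rewrite permK.
by apply: contra k2 => /eqP->; rewrite permK.
Qed.

(* The inversion set of the join is the transitive closure of the union of
   the two inversion sets. *)
Definition jinv x y : rel 'I_n := fun i k => (i < k) && (bef x k i || bef y k i).
Lemma jinv_le x y i k : connect (jinv x y) i k -> i <= k.
Proof.
move=> /connectP[s]; elim: s i => [|a s IH] i /=; first by move=> _ ->.
move=> /andP[/andP[ia _] h] e; exact: leq_trans (ltnW ia) (IH _ h e).
Qed.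

(** Unless the chain visits [j], some step of it passes over [j]. In the word inverting this step,
    [j] is inverted with one end of the step. So the closure is co-transitive as well, as an
    inversion set must be. *)
Lemma jinv_split x y i j k : connect (jinv x y) i k -> i < j -> j < k ->
  connect (jinv x y) i j || connect (jinv x y) j k.
Proof.
move=> /connectP[s]; elim: s i => [|a s IH] i /=; first by move=> _ -> ? ?; lia.
move=> /andP[ia h] e ij jk.
have ak : connect (jinv x y) a k by apply/connectP; exists s.
case: (ltngtP a j) => [aj|ja|/val_inj<-]; last by rewrite ak orbT.
  case/orP: (IH a h e aj jk) => h'; last by rewrite h' orbT.
  by rewrite (connect_trans (connect1 ia) h').
have := ia; rewrite {1}/jinv => /andP[ialt hxy].
have : jinv x y i j || jinv x y j a.
  rewrite /jinv ij ja /=.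
  have split_w w : bef w a i -> bef w j i || bef w a j.
    move=> ai; case/orP: (bef_total w (ltn_neq ij)) => [ij'|->//].
    by rewrite (bef_trans ai ij') orbT.
  by case/orP: hxy => /split_w /orP[] ->; rewrite ?orbT.
case/orP => h'; first by rewrite (connect1 h').
by rewrite (connect_trans (connect1 h') ak) orbT.
Qed.

Lemma join_exists x y : exists w, is_join x y w.
Proof.
pose C := connect (jinv x y).
pose lt i k := (i < k) && ~~ C i k || (k < i) && C k i.
have Ctr : transitive C by move=> ? ? ?; apply: connect_trans.
have Cs i j k : C i k -> i < j -> j < k -> C i j || C j k by apply: jinv_split.
have [||i j ij|w hw] := @order_perm lt.
- by move=> i; rewrite /lt ltnn.
- move=> j i k; rewrite /lt => h1 h2.
  have ik : i != k :> nat.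
    apply/negP => /eqP/val_inj e; move: h1 h2; rewrite e.
    by case: (C k j); case: (C j k); lia.
  (* Whatever the order of the three values, transitivity of [C] and the splitting [Cs] decide; all
     their instances are supplied. *)
  move: h1 h2 (Cs i j k) (Cs i k j) (Cs j i k) (Cs j k i) (Cs k i j) (Cs k j i).
  move: (Ctr j i k) (Ctr k i j) (Ctr i j k) (Ctr k j i) (Ctr i k j) (Ctr j k i).
  case: (C i j); case: (C j k); case: (C i k); case: (C j i); case: (C k j);
  case: (C k i) => /=; lia.
- rewrite /lt; have ij' : i != j :> nat by [].
  by move: ij'; case: (C i j); case: (C j i); lia.
exists w; split; [|split].
- apply/wleP => i j ij h; rewrite hw /lt ij /=.
  by apply/orP; right; apply: connect1; rewrite /jinv ij h.
- apply/wleP => i j ij h; rewrite hw /lt ij /=.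
  by apply/orP; right; apply: connect1; rewrite /jinv ij h orbT.
move=> z /wleP xz /wleP yz; apply/wleP => i j ij; rewrite hw /lt ij /=.
rewrite ltnNge (ltnW ij) /= => /connectP[s].
elim: s i ij => [|a s IH] i ij /=; first by move=> _ e; move: ij; rewrite e ltnn.
move=> /andP[/andP[ia h] ps] e.
have zai : bef z a i by case/orP: h; [apply: xz|apply: yz].
case: (ltngtP a j) => [aj|ja|/val_inj<-//].
  exact: bef_trans (IH a aj ps e) zai.
by have := @jinv_le x y a j; rewrite leqNgt ja => /(_ _)/negP; case => //;
  apply/connectP; exists s.
Qed.

Lemma reverse_exists w : exists w', forall i j, bef w' i j = bef w j i.
Proof.
apply: order_perm => [i|j i k h h'|i j /(bef_total w)].
- exact: bef_irr.
- exact: bef_trans h' h.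
- by rewrite orbC.
Qed.

(** Reversing words turns the weak order upside down, so the meet is the reversed join of the
    reversed words. *)
Lemma meet_exists x y : exists w, is_meet x y w.
Proof.
have [x' hx] := reverse_exists x; have [y' hy] := reverse_exists y.
have [j [xj [yj hj]]] := join_exists x' y'; have [m hm] := reverse_exists j.
have rev u u' w w' : (forall i j, bef u' i j = bef u j i) ->
    (forall i j, bef w' i j = bef w j i) -> wle u w -> wle w' u'.
  move=> eu ew uw; apply/wleP => i k ik; rewrite ew eu; exact: wle_bef uw ik.
have sym u u' : (forall i j, bef u' i j = bef u j i) ->
  forall i j, bef u i j = bef u' j i by move=> h ? ?; rewrite h.
exists m; split; [|split].
- exact: rev (sym _ _ hx) hm xj.
- exact: rev (sym _ _ hy) hm yj.
move=> z zx zy; have [z' hz] := reverse_exists z.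
have xz' : wle x' z' := rev _ _ _ _ hz hx zx.
have yz' : wle y' z' := rev _ _ _ _ hz hy zy.
exact: rev _ _ _ _ hm (sym _ _ hz) (hj z' xz' yz').
Qed.

(* A pair on which [u] and [w] disagree, chosen at minimal distance in [u], is
   adjacent. *)
Lemma wle_cover u w : wle u w -> u != w ->
  exists p q, [/\ p < q, adj u p q & bef w q p].
Proof.
move=> uw neq.
have [[p q] /andP[/= pq qp]] : exists pq : 'I_n * 'I_n, bef u pq.1 pq.2 && bef w pq.2 pq.1.
  apply/existsP; apply: contraR neq => /existsPn h; apply/eqP/(wle_anti uw).
  apply/wleP => i j ij wji; have := h (i, j); rewrite /= wji andbT.
  by rewrite (befN u (ltn_neq ij)).
have [k] := ubnP ((u^-1)%g q - (u^-1)%g p); elim: k p q pq qp => // k IH p q pq qp lek.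
have [/existsP[c /andP[pc cq]]|nc] := boolP [exists c, bef u p c && bef u c q].
  have [h|h] := boolP (bef w c p).
    by apply: (IH p c) => //; move: pc cq; rewrite /bef; lia.
  apply: (IH c q) => //; last by move: pc cq; rewrite /bef; lia.
  by apply: bef_trans qp _; rewrite (befN _ (_ : c != p)) // eq_sym (bef_neq pc).
exists p, q; split=> //.
- case: (ltngtP p q) => // [ltqp|/val_inj e]; last by move: pq; rewrite e bef_irr.
  by have := wle_bef uw ltqp qp => /(bef_asym pq).
- apply/adjP; split=> // c pc cq; case/existsP: nc.
  by exists c; rewrite pc cq.
Qed.

End WordOrder.

(** * Forcing *)

Section Congruence.
Variables (n : nat) (R : rel {perm 'I_n}).
Hypothesis congR : lattice_congruence R.
Implicit Types (u v w x y z g m : {perm 'I_n}) (i j k p q c d e : 'I_n).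

Lemma cong_refl x : R x x.
Proof. by case: congR => /(_ x x x)[]. Qed.
Lemma cong_sym x y : R x y -> R y x.
Proof. by case: congR => eqR _ xy; have [_ /(_ xy) <-] := eqR x y x; apply: cong_refl. Qed.
Lemma cong_trans y x z : R x y -> R y z -> R x z.
Proof. by case: congR => eqR _ xy yz; have [_ /(_ xy) ->] := eqR x y z. Qed.

Lemma is_join_le x z : wle x z -> is_join x z z.
Proof. by split; [|split; [exact: wle_refl|]]. Qed.
Lemma is_meet_le x z : wle z x -> is_meet x z z.
Proof. by split; [|split; [exact: wle_refl|]]. Qed.
Lemma is_joinC x y z : is_join x y z -> is_join y x z.
Proof. by move=> [h [h' h'']]; split=> //; split=> // w wx wy; apply: h''. Qed.
Lemma is_meetC x y z : is_meet x y z -> is_meet y x z.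
Proof. by move=> [h [h' h'']]; split=> //; split=> // w wx wy; apply: h''. Qed.

Lemma cong_join x y z w1 w2 : R x y -> is_join x z w1 -> is_join y z w2 -> R w1 w2.
Proof. by case: congR => _ [h _]; apply: h. Qed.
Lemma cong_meet x y z w1 w2 : R x y -> is_meet x z w1 -> is_meet y z w2 -> R w1 w2.
Proof. by case: congR => _ [_ h]; apply: h. Qed.

(** Joining both ends with [z] turns [x] into [z] and leaves [y] unchanged, so [z] and [y] are
    equivalent. *)
Lemma cong_convex x z y : wle x z -> wle z y -> R x y -> R x z.
Proof.
move=> xz zy xy; apply: cong_trans (xy) _; apply: cong_sym.
exact: cong_join xy (is_join_le xz) (is_joinC (is_join_le zy)).
Qed.

(** Joining [g1] and [g2] with [v] gives [v] and an equivalent [z] above it. The last hypothesis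
    puts [z] above the swapped word too, and convexity contracts the edge. *)
Lemma cong_push_up g1 g2 v p q : R g1 g2 -> wle g1 v -> adj v p q -> p < q ->
  (forall z, wle v z -> wle g2 z -> bef z q p) -> R v (sw v p q).
Proof.
move=> g12 g1v a pq H; have [z zj] := join_exists g2 v.
have vz : R v z := cong_join g12 (is_join_le g1v) zj.
have [g2z [lvz _]] := zj.
apply: (cong_convex (wle_sw a pq) _ vz); apply/wleP => i k ik.
rewrite inv_sw // => /orP[/andP[/eqP-> /eqP->]|]; first exact: H.
exact: (wleP _ _ lvz).
Qed.

(** Dually, the meet [m] of [g1] with the swapped word is equivalent to that word, and the last
    hypothesis puts [m] below [v]. *)
Lemma cong_push_down g1 g2 v p q : R g1 g2 -> adj v p q -> p < q ->
  wle (sw v p q) g2 ->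
  (forall m, wle m (sw v p q) -> wle m g1 -> bef m p q) -> R v (sw v p q).
Proof.
move=> g12 a pq vg2 H; have [m mm] := meet_exists g1 (sw v p q).
have mv : R m (sw v p q) := cong_meet g12 mm (is_meet_le vg2).
have [mg1 [lmv _]] := mm.
have lm : wle m v.
  apply/wleP => i k ik h; have := (wleP _ _ lmv) _ _ ik h.
  rewrite inv_sw // => /orP[/andP[/eqP ei /eqP ek]|//]; subst.
  by case: (bef_asym (H m lmv mg1) h).
by apply: cong_trans (mv); apply: cong_sym; apply: cong_convex lm (wle_sw a pq) mv.
Qed.

(* All edges of a fence are above one another's least edge: push the
   congruence down to it, then up again. *)
Lemma cong_same_fence z v p q : p < q -> adj z p q -> adj v p q ->
  (forall c, p < c -> c < q -> bef z c p = bef v c p) ->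
  R z (sw z p q) -> R v (sw v p q).
Proof.
move=> pq az av pat Rz.
(* The least word of the fence: values below [p], left inner values, [p], [q], right inner values,
   values above [q]. Each block is increasing because the sort starts from the identity. *)
pose cls i := if i < p then 0 else if q < i then 5 else
  if i == p :> nat then 2 else if i == q :> nat then 3 else
  if bef z i p then 1 else 4.
have [t ht] := reorder cls 1%g.
have b1 i j : bef 1%g i j = (i < j) by rewrite /bef invg1 !perm1.
have cls_lo i : i < p -> cls i = 0 by rewrite /cls => ->.
have cls_hi i : q < i -> cls i = 5.
  by rewrite /cls => qi; rewrite qi ltnNge (ltnW (ltn_trans pq qi)).
have cls_in i : p < i -> i < q -> cls i = if bef z i p then 1 else 4.
  move=> pi iq; rewrite /cls !ltnNge (ltnW pi) (ltnW iq) /=.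
  by rewrite gtn_eqF // ltn_eqF.
have clsp : cls p = 2 by rewrite /cls ltnn eqxx ltnNge (ltnW pq).
have clsq : cls q = 3.
  by rewrite /cls ltnn eqxx ltnNge (ltnW pq) /= gtn_eqF.
have at_ : adj t p q.
  apply/adjP; split; first by rewrite ht clsp clsq.
  move=> c; rewrite !ht !b1 clsp clsq.
  case: (ltngtP c p) => [cp|pc|/val_inj->]; first by rewrite cls_lo.
    case: (ltngtP c q) => [cq|qc|/val_inj->]; last by rewrite clsq.
      by rewrite cls_in //; case: ifP.
    by rewrite cls_hi.
  by rewrite clsp.
have tle w : adj w p q -> (forall c, p < c -> c < q -> bef z c p = bef w c p) ->
    wle t w.
  move=> aw patw; have [wpq _] := adjP _ _ _ aw.
  have inq i : p < i -> i < q -> bef z i p = false -> bef w q i.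
    move=> pi iq h; have ip : i != p by rewrite eq_sym ltn_neq.
    by rewrite -(adj_out aw ip (ltn_neq iq)) (befN _ ip) -patw ?h.
  apply/wleP => i j ij; rewrite ht !b1 [j < i]ltnNge (ltnW ij) andbF orbF => cl.
  have {}cl : [/\ p <= i, j <= q & cls j < cls i].
    split=> //; first by rewrite leqNgt; apply: contraTN cl => /cls_lo->.
    rewrite leqNgt; apply: contraTN cl => /cls_hi->.
    by rewrite /cls -leqNgt; do ![case: ifP => //].
  case: cl; case: (ltngtP p i) => // [pi|/val_inj ei] _.
    case: (ltngtP j q) => // [jq|/val_inj ej] _.
      rewrite !cls_in ?(ltn_trans pi ij) ?(ltn_trans ij jq) //.
      case: ifP => [hj|_]; case: ifP => // hi _.
      rewrite patw ?(ltn_trans pi ij) // in hj.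
      exact: bef_trans hj (bef_trans wpq (inq _ pi (ltn_trans ij jq) hi)).
    subst j; rewrite clsq cls_in //; case: ifP => // h _; exact: inq.
  subst i; rewrite clsp; case: (ltngtP j q) => // [jq|/val_inj ej] _.
    by rewrite cls_in // -patw //; case: ifP.
  by subst j; rewrite clsq.
have Rt : R t (sw t p q).
  apply: (cong_push_down Rz at_ pq).
    apply/wleP => i j ij; rewrite !inv_sw //.
    case/orP => [->//|h]; apply/orP; right.
    exact: (wleP _ _ (tle z az (fun _ _ _ => erefl))) h.
  by move=> m _ mz; apply: (wle_bef mz pq); case/adjP: az.
apply: (cong_push_up Rt (tle v av pat) av pq) => w _ tw.
by apply: (wleP _ _ tw) => //; case/adjP: (adj_sw at_).
Qed.

(** The pattern is a predicate read only on ]c,d[, so that one pattern serves nested arcs without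
    being restricted. *)
Definition contracted c d (M : pred 'I_n) : Prop :=
  forall v, adj v c d -> (forall e, c < e -> e < d -> M e = bef v e c) ->
  R v (sw v c d).

(* An edge of f(c,d,_) placed below [v] is pushed up by joining with [v]: in the
   join q precedes d, d precedes c and c precedes p. *)
Lemma contracted_push_up v p q c d : adj v p q -> p <= c -> c < d -> d <= q ->
  (p = c \/ bef v c p) -> (d = q \/ bef v q d) ->
  contracted c d (fun e => bef v e p) -> R v (sw v p q).
Proof.
move=> a pc cd dq hc hd C.
have pq : p < q by lia.
(* [v0] reads left values, [c], [p], [q], [d], right values, and stays in the fence of [v]; [g]
   reads left values, [p], [c], [d], [q], right values. If [p = c] or [d = q], the first matching
   test decides the place. *)
pose other i := if bef v i p then 1 else 6.
pose cls0 i := if i == p :> nat then 3 else if i == q :> nat then 4 else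
  if i == c :> nat then 2 else if i == d :> nat then 5 else other i.
pose cls1 i := if i == c :> nat then 3 else if i == d :> nat then 4 else
  if i == p :> nat then 2 else if i == q :> nat then 5 else other i.
have other16 i : (other i = 1) \/ (other i = 6).
  by rewrite /other; case: ifP; auto.
have [v0 h0] := reorder cls0 v; have [g hg] := reorder cls1 v.
have a0 : adj v0 p q.
  apply/adjP; split.
    by rewrite h0 /cls0 !eqxx [q == p :> nat]gtn_eqF.
  move=> e he he'; move: (bef_neq he) (bef_neq he') (he) (he').
  rewrite -!val_eqE /= !h0 /cls0 !eqxx [q == p :> nat]gtn_eqF //.
  by move: (other16 e) pc cd dq pq; generalize (other e); clear;
    do 4?[case: (eqVneq (e : nat) _) => ? /=]; lia.
have ag : adj g c d.
  apply/adjP; split.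
    by rewrite hg /cls1 !eqxx [d == c :> nat]gtn_eqF.
  move=> e he he'; move: (bef_neq he) (bef_neq he') (he) (he').
  rewrite -!val_eqE /= !hg /cls1 !eqxx [d == c :> nat]gtn_eqF //.
  by move: (other16 e) pc cd dq pq; generalize (other e); clear;
    do 4?[case: (eqVneq (e : nat) _) => ? /=]; lia.
have patg e : c < e -> e < d -> bef v e p = bef g e c.
  move=> ce ed; rewrite hg /cls1 !eqxx (gtn_eqF ce) (ltn_eqF ed).
  rewrite (_ : (e == p :> nat) = false) 1?(_ : (e == q :> nat) = false); try lia.
  by rewrite /other; case: ifP.
have gv0 : wle g v0.
  apply/wleP => i j ij; rewrite hg h0 /cls0 /cls1.
  move: (other16 i) (other16 j) ij pc cd dq.
  generalize (other i) (other j); clear.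
  do 4?[case: (eqVneq (i : nat) _) => ? /=];
    by do 4?[case: (eqVneq (j : nat) _) => ? /=]; lia.
suff R0 : R v0 (sw v0 p q).
  apply: (cong_same_fence pq a0 a _ R0) => e pe eq.
  rewrite h0 /cls0 !eqxx (gtn_eqF pe) (ltn_eqF eq).
  case: (eqVneq (e : nat) c) => [/val_inj ee|_].
    by subst e; case: hc => [e|->//]; move: pe; rewrite e ltnn.
  case: (eqVneq (e : nat) d) => [/val_inj ee|_]; last by rewrite /other; case: ifP.
  subst e; case: hd => [e|h]; first by move: eq; rewrite e ltnn.
  have [vpq _] := adjP _ _ _ a; apply/esym/negP => h'.
  exact: bef_asym (bef_trans h h') vpq.
apply: (cong_push_up (C g ag patg) gv0 a0 pq) => w v0w gw.
have wdc : bef w d c.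
  by apply: (wleP _ _ gw) => //; case/adjP: (adj_sw ag).
have wdp : bef w d p.
  case: (ltngtP p c) pc => // [lpc|/val_inj->//] _.
  apply: bef_trans wdc _; apply: (wleP _ _ v0w) => //.
  by rewrite h0 /cls0 !eqxx (gtn_eqF lpc) (_ : (c == q :> nat) = false) //; lia.
case: (ltngtP d q) dq => // [ldq|/val_inj<-//] _.
apply: bef_trans _ wdp; apply: (wleP _ _ v0w) => //.
rewrite h0 /cls0 !eqxx (ltn_eqF ldq) gtn_eqF //.
by rewrite (_ : (d == p :> nat) = false) 1?(_ : (d == c :> nat) = false) //; lia.
Qed.

(** Dual to pushing up, with [c] on the right and [d] on the left. Here [g] reads left values, [q],
    [c], [d], [p], right values; in the meet [p] precedes [c], [c] precedes [d] and [d] precedes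
    [q]. *)
Lemma contracted_push_down v p q c d : adj v p q -> p <= c -> c < d -> d <= q ->
  (p = c \/ bef v p c) -> (d = q \/ bef v d p) ->
  contracted c d (fun e => bef v e p) -> R v (sw v p q).
Proof.
move=> a pc cd dq hc hd C.
have pq : p < q by lia.
pose other i := if bef v i p then 1 else 6.
pose cls0 i := if i == p :> nat then 3 else if i == q :> nat then 4 else
  if i == c :> nat then 5 else if i == d :> nat then 2 else other i.
pose cls1 i := if i == c :> nat then 3 else if i == d :> nat then 4 else
  if i == p :> nat then 5 else if i == q :> nat then 2 else other i.
have other16 i : (other i = 1) \/ (other i = 6).
  by rewrite /other; case: ifP; auto.
have [v0 h0] := reorder cls0 v; have [g hg] := reorder cls1 v.
have a0 : adj v0 p q.
  apply/adjP; split.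
    by rewrite h0 /cls0 !eqxx [q == p :> nat]gtn_eqF.
  move=> e he he'; move: (bef_neq he) (bef_neq he') (he) (he').
  rewrite -!val_eqE /= !h0 /cls0 !eqxx [q == p :> nat]gtn_eqF //.
  by move: (other16 e) pc cd dq pq; generalize (other e); clear;
    do 4?[case: (eqVneq (e : nat) _) => ? /=]; lia.
have ag : adj g c d.
  apply/adjP; split.
    by rewrite hg /cls1 !eqxx [d == c :> nat]gtn_eqF.
  move=> e he he'; move: (bef_neq he) (bef_neq he') (he) (he').
  rewrite -!val_eqE /= !hg /cls1 !eqxx [d == c :> nat]gtn_eqF //.
  by move: (other16 e) pc cd dq pq; generalize (other e); clear;
    do 4?[case: (eqVneq (e : nat) _) => ? /=]; lia.
have patg e : c < e -> e < d -> bef v e p = bef g e c.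
  move=> ce ed; rewrite hg /cls1 !eqxx (gtn_eqF ce) (ltn_eqF ed).
  rewrite (_ : (e == p :> nat) = false) 1?(_ : (e == q :> nat) = false); try lia.
  by rewrite /other; case: ifP.
have v0g : wle (sw v0 p q) (sw g c d).
  apply/wleP => i j ij; rewrite !inv_sw // -!val_eqE /= hg h0 /cls0 /cls1.
  move: (other16 i) (other16 j) ij pc cd dq.
  generalize (other i) (other j); clear.
  do 4?[case: (eqVneq (i : nat) _) => ? /=];
    by do 4?[case: (eqVneq (j : nat) _) => ? /=]; lia.
suff R0 : R v0 (sw v0 p q).
  apply: (cong_same_fence pq a0 a _ R0) => e pe eq.
  rewrite h0 /cls0 !eqxx (gtn_eqF pe) (ltn_eqF eq).
  case: (eqVneq (e : nat) c) => [/val_inj ee|_].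
    subst e; case: hc => [e|h]; first by move: pe; rewrite e ltnn.
    by apply/esym/negP => /(bef_asym h).
  case: (eqVneq (e : nat) d) => [/val_inj ee|_]; last by rewrite /other; case: ifP.
  by subst e; case: hd => [e|->//]; move: eq; rewrite e ltnn.
apply: (cong_push_down (C g ag patg) a0 pq v0g) => m mv0 mg.
have mcd : bef m c d by apply: (wle_bef mg cd); case/adjP: ag.
have mpd : bef m p d.
  case: (ltngtP p c) pc => // [lpc|/val_inj->//] _.
  apply: bef_trans _ mcd; apply: (wle_bef mv0 lpc).
  have cq : (c == q :> nat) = false by lia.
  rewrite bef_sw_adj // -!val_eqE /= cq eqxx (ltn_eqF pq) /=.
  by rewrite h0 /cls0 eqxx (gtn_eqF lpc) cq eqxx.
case: (ltngtP d q) dq => // [ldq|/val_inj<-//] _.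
apply: bef_trans mpd _; apply: (wle_bef mv0 ldq).
rewrite bef_sw_adj // -!val_eqE /= (ltn_eqF ldq) eqxx andbT.
have dp : (d == p :> nat) = false by lia.
have dc : (d == c :> nat) = false by lia.
by rewrite dp (gtn_eqF pq) h0 /cls0 (gtn_eqF pq) dp dc eqxx (ltn_eqF ldq) eqxx.
Qed.

(* When c and d lie on the same side of p, q, the fence of (c,q) is forced
   first. *)
Lemma contracted_forces v p q c d : adj v p q -> p <= c -> c < d -> d <= q ->
  contracted c d (fun e => bef v e p) -> R v (sw v p q).
Proof.
move=> a pc cd dq C; have [vpq _] := adjP _ _ _ a.
have cq : c < q by lia.
(* The arcs (c,d) and (c,q) share their left end, which satisfies the side condition of both pushes;
   only the side of [d] selects one. *)
have extend : c <> p -> d <> q ->  bef v c p = bef v d p ->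
    contracted c q (fun e => bef v e p).
  move=> cp dq' e v1 a1 pat1.
  have C1 : contracted c d (fun e => bef v1 e c).
    by move=> v2 a2 pat2; apply: C => // k ck kd; rewrite pat1 ?pat2 //; lia.
  have ldq : d < q by move: dq; rewrite leq_eqVlt => /orP[/eqP/val_inj|].
  case: (boolP (bef v d p)) => h.
    by apply: (contracted_push_down a1 _ cd dq) => //; [left|right; rewrite -pat1].
  apply: (contracted_push_up a1 _ cd dq) => //; [by left|right].
  have dc : d != c by rewrite eq_sym ltn_neq.
  rewrite -(adj_out a1 dc (ltn_neq ldq)).
  by rewrite (befN _ dc) -pat1.
have aout k : p < k -> k < q -> ~~ bef v k p -> bef v p k * bef v q k.
  move=> pk kq h; have kp : k != p by rewrite eq_sym ltn_neq.
  by rewrite -!(adj_out a kp (ltn_neq kq)) !(befN _ kp) h.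
case: (eqVneq c p) => [ec|ncp].
  case: (eqVneq d q) => [ed|ndq].
    by apply: (contracted_push_up a pc cd dq) => //; [left|left].
  have ldq : d < q by move: dq ndq; rewrite leq_eqVlt -val_eqE => /orP[->|].
  have [h|h] := boolP (bef v d p).
    by apply: (contracted_push_down a pc cd dq) => //; [left|right].
  apply: (contracted_push_up a pc cd dq) => //; [by left|right].
  by have [] := aout d (leq_ltn_trans pc cd) ldq h.
have lpc : p < c by move: pc ncp; rewrite leq_eqVlt eq_sym -val_eqE => /orP[->|].
have [hc|hc] := boolP (bef v c p).
  have upq : contracted c q (fun e => bef v e p) -> R v (sw v p q).
    by apply: contracted_push_up => //; [right|left].
  case: (eqVneq d q) => [ed|ndq]; first by apply: upq; rewrite -ed.
  have [h|h] := boolP (bef v d p).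
    by apply: upq; apply: extend; [exact/eqP|exact/eqP|rewrite hc h].
  have ldq : d < q by move: dq ndq; rewrite leq_eqVlt -val_eqE => /orP[->|].
  apply: (contracted_push_up a pc cd dq) => //; [by right|right].
  by have [] := aout d (leq_ltn_trans pc cd) ldq h.
have hc' : bef v p c by have [] := aout c lpc cq hc.
have downq : contracted c q (fun e => bef v e p) -> R v (sw v p q).
  by apply: contracted_push_down => //; [right|left].
case: (eqVneq d q) => [ed|ndq]; first by apply: downq; rewrite -ed.
have [h|h] := boolP (bef v d p).
  by apply: (contracted_push_down a pc cd dq) => //; [right|right].
by apply: downq; apply: extend; [exact/eqP|exact/eqP|rewrite (negbTE hc) (negbTE h)].
Qed.

End Congruence.

(** * Degrees in the quotient graph *)

Section WeakCovers.
Variable n : nat.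
Implicit Types (u v w z m : {perm 'I_n}) (p q : 'I_n).

Lemma adj_rev w w' p q : (forall i j, bef w' i j = bef w j i) ->
  adj w' p q -> adj w q p.
Proof.
move=> h /adjP[pq H]; apply/adjP; rewrite -h; split=> // c qc cp.
by apply: (H c); rewrite h.
Qed.

Lemma wle_cover_down u w : wle u w -> u != w ->
  exists p q, [/\ p < q, adj w q p & bef u p q].
Proof.
move=> uw neq; have [u' hu] := reverse_exists u; have [w' hw] := reverse_exists w.
have wu' : wle w' u'.
  by apply/wleP => i j ij; rewrite hw hu; apply: wle_bef.
have neq' : w' != u'.
  apply: contra neq => /eqP e; apply/eqP/bef_inj => i j.
  by rewrite -hu -hw e.
have [p [q [pq a qp]]] := wle_cover wu' neq'.
by exists p, q; split; rewrite -?hu //; apply: adj_rev hw a.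
Qed.

Lemma wle_sw_le w z p q : wle w z -> adj w p q -> p < q -> bef z q p ->
  wle (sw w p q) z.
Proof.
move=> wz a pq zqp; apply/wleP => i j ij; rewrite inv_sw //.
by case/orP => [/andP[/eqP-> /eqP->]//|]; apply: (wleP _ _ wz).
Qed.

Lemma wle_sw_ge w z p q : wle z (sw w p q) -> adj w p q -> p < q -> bef z p q ->
  wle z w.
Proof.
move=> zw a pq zpq; apply/wleP => i j ij h.
have := (wleP _ _ zw) _ _ ij h; rewrite inv_sw //.
case/orP => [/andP[/eqP ei /eqP ej]|//]; subst.
by case: (bef_asym h).
Qed.

End WeakCovers.

(** * Classes as intervals, and the order on the quotient *)

Section Quotient.
Variables (n : nat) (R : rel {perm 'I_n}).
Hypothesis congR : lattice_congruence R.
Implicit Types (u v w x y z m : {perm 'I_n}) (i j k p q r s t : 'I_n).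

Let Rsym := cong_sym congR.
Let Rtrans := cong_trans congR.
Let Rrefl := cong_refl congR.

Definition is_top x y := R x y /\ forall w, R x w -> wle w y.
Definition is_bot y x := R y x /\ forall w, R y w -> wle x w.

(** The class is closed under meets, and a meet with an element having the fewest inversions cannot
    have fewer. *)
Lemma bot_exists z : exists x, is_bot z x.
Proof.
have [x zx xmin] := @arg_minnP _ z (R z) (fun w => #|inv_set w|) (Rrefl z).
exists x; split=> // w zw; have [m mm] := meet_exists w x.
have xm : R x m.
  have xw : R x w := Rtrans (Rsym zx) zw.
  exact: (cong_meet congR) xw (is_meet_le (wle_refl x)) mm.
have [mw [mx _]] := mm; apply: wle_trans mw.
rewrite /wle; suff -> : inv_set m = inv_set x by [].
by apply/eqP; rewrite eqEcard [_ \subset _]mx xmin //; apply: Rtrans xm.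
Qed.

Lemma top_exists z : exists y, is_top z y.
Proof.
have [y zy ymax] := @arg_maxnP _ z (R z) (fun w => #|inv_set w|) (Rrefl z).
exists y; split=> // w zw; have [m mm] := join_exists w y.
have ym : R y m.
  have yw : R y w := Rtrans (Rsym zy) zw.
  exact: (cong_join congR) yw (is_join_le (wle_refl y)) mm.
have [wm [lym _]] := mm; apply: (wle_trans wm).
rewrite /wle; suff -> : inv_set m = inv_set y by [].
apply/esym/eqP; rewrite eqEcard [_ \subset _]lym /=; apply: ymax.
exact: Rtrans ym.
Qed.

Lemma rclass_eq u v : (rclass R u == rclass R v) = R u v.
Proof.
apply/eqP/idP => [e|uv]; first by have := Rrefl v; rewrite -[R v v]in_set -/(rclass R v) -e inE.
by apply/setP => w; rewrite !inE; apply/idP/idP; apply: Rtrans => //; apply: Rsym.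
Qed.

Lemma rclass_qverts z : rclass R z \in qverts R.
Proof. exact: imset_f. Qed.

Lemma qle_wle u v u' v' : R u u' -> R v v' -> wle u' v' -> qle (rclass R u) (rclass R v).
Proof.
move=> uu vv le; apply/existsP; exists u'; rewrite inE uu /=.
by apply/existsP; exists v'; rewrite inE vv.
Qed.

(** Some [u1] lies below some [v1]. As [w] is equivalent to [u1], its join with [v1] is equivalent
    to [v1], hence below the top. The existential [qle] thus bounds every word of the lower
    class. *)
Lemma qle_top u v y w : qle (rclass R u) (rclass R v) -> is_top v y -> R u w -> wle w y.
Proof.
move=> /exists_inP[u1]; rewrite inE => uu1 /exists_inP[v1]; rewrite inE => vv1 le.
move=> [vy hy] uw; have [m mm] := join_exists w v1; have [wm _] := mm.
apply: (wle_trans wm); apply: hy; apply: (Rtrans vv1).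
have u1w : R u1 w by apply: Rtrans uw; apply: Rsym.
exact: (cong_join congR) u1w (is_join_le le) mm.
Qed.

Lemma qle_bot u v x w : qle (rclass R u) (rclass R v) -> is_bot u x -> R v w -> wle x w.
Proof.
move=> /exists_inP[u1]; rewrite inE => uu1 /exists_inP[v1]; rewrite inE => vv1 le.
move=> [ux hx] vw; have [m mm] := meet_exists w u1; have [mw _] := mm.
apply: wle_trans mw; apply: hx; apply: (Rtrans uu1).
have v1w : R v1 w by apply: Rtrans vw; apply: Rsym.
exact: (cong_meet congR) v1w (is_meet_le le) mm.
Qed.

Lemma qle_anti u v :
  qle (rclass R u) (rclass R v) -> qle (rclass R v) (rclass R u) -> R u v.
Proof.
move=> uv vu; have [y1 t1] := top_exists u; have [y2 t2] := top_exists v.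
have e : y1 = y2.
  by apply: wle_anti; [apply: qle_top uv t2 _|apply: qle_top vu t1 _];
     [case: t1|case: t2].
by case: t1 t2 => uy1 _ [vy2 _]; apply: Rtrans uy1 _; rewrite e; apply: Rsym.
Qed.

(** A class strictly between would contain a word between [z] and [sw z p q], but these two differ
    by a single inversion. *)
Lemma qcover_sw z p q : adj z p q -> p < q -> ~~ R z (sw z p q) ->
  qcover R (rclass R z) (rclass R (sw z p q)).
Proof.
move=> a pq nR; rewrite /qcover !imset_f //= /qlt rclass_eq nR /=.
rewrite (@qle_wle z _ z (sw z p q)) ?wle_sw //=.
apply/forall_inP => _ /imsetP[c _ ->]; rewrite !rclass_eq.
apply/negP => /andP[/andP[nzc zc] /andP[ncz cz]].
have [y ty] := top_exists c; have zy : wle z y by apply: qle_top zc ty _.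
have [cy _] := ty; case/exists_inP: cz => c1; rewrite inE => cc1.
case/exists_inP=> v1; rewrite inE => zv1 le.
(* [m1] is in the class of [c] because [c1] lies below [v1]. Replacing [v1] by the equivalent
   [sw z p q] keeps [m] in that class, between [z] and [sw z p q]. *)
have [m1 mm1] := meet_exists y v1; have [m mm] := meet_exists (sw z p q) y.
have c1m1 : R c1 m1.
  have c1y : R c1 y by apply: Rtrans cy; apply: Rsym.
  exact: (cong_meet congR) c1y (is_meetC (is_meet_le le)) mm1.
have m1m : R m1 m.
  exact: (cong_meet congR) (Rsym zv1) (is_meetC mm1) mm.
have cm : R c m by apply: Rtrans cc1 _; apply: Rtrans m1m.
have [mz' [my hm]] := mm; have zm : wle z m by apply: hm; rewrite ?wle_sw.
have [h|h] := boolP (bef m q p).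
  have e : m = sw z p q by apply: wle_anti => //; apply: wle_sw_le.
  by move: ncz; rewrite -e cm.
have e : m = z.
  apply: wle_anti => //; apply: (wle_sw_ge mz' a pq).
  by rewrite (befN _ (_ : q != p)) ?h // eq_sym ltn_neq.
by move: nzc; rewrite -e Rsym.
Qed.

(** * The poset of a class, and its cover relations as edges of the quotient graph *)

Section Class.
Variables x y : {perm 'I_n}.
Hypothesis (topy : is_top x y) (botx : is_bot x x).

(* The class is the set of linear extensions of this order. *)
Definition ord_rel : rel 'I_n := fun i j => bef x i j && bef y i j.
Notation P := ord_rel.
Definition ord_cover i j : bool := P i j && [forall t, ~~ (P i t && P t j)].

Lemma ord_irr i : P i i = false. Proof. by rewrite /P bef_irr. Qed.
Lemma ord_trans : transitive P.
Proof. by move=> j i k /andP[h h'] /andP[/(bef_trans h) g /(bef_trans h') g']; apply/andP. Qed.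
Lemma ord_asym i j : P i j -> P j i -> False.
Proof. by move=> /ord_trans h /h; rewrite ord_irr. Qed.
Lemma ord_neq i j : P i j -> i != j.
Proof. by apply: contraTneq => ->; rewrite ord_irr. Qed.
Lemma ord_bef_top i j : P i j -> bef y i j. Proof. by case/andP. Qed.

Lemma ord_coverP i j :
  reflect (P i j /\ forall t, P i t -> P t j -> False) (ord_cover i j).
Proof.
apply: (iffP andP) => -[h].
  by move=> /forallP h'; split=> // c hi hj; move/negP: (h' c); rewrite hi hj.
by move=> h'; split=> //; apply/forallP => c; apply/negP => /andP[]; apply: h'.
Qed.

Lemma class_bef z i j : R x z -> P i j -> bef z i j.
Proof.
move=> xz /andP[xij yij]; have [_ /(_ _ xz) xlez] := botx.
have [_ /(_ _ xz) zley] := topy.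
case: (ltngtP i j) => [ij|ji|/val_inj e].
- exact: wle_bef zley ij yij.
- exact: (wleP _ _ xlez).
- by move: xij; rewrite e bef_irr.
Qed.

Lemma wle_bot_top : wle x y.
Proof. by have [_ h] := botx; apply: h; case: topy. Qed.

(** [P] contains all inversions of [x] and all non-inversions of [y], so a linear extension lies
    between [x] and [y]. *)
Lemma class_of_bef z : (forall i j, P i j -> bef z i j) -> R x z.
Proof.
move=> h; have [xy _] := topy.
apply: (cong_convex congR _ _ xy); apply/wleP => i j ij hji.
  by apply: h; rewrite /P hji (wleP _ _ wle_bot_top).
have nij : i != j by rewrite ltn_neq.
rewrite (befN _ nij); apply/negP => yij; case: (bef_asym hji); apply: h.
by rewrite /P yij (wle_bef wle_bot_top ij yij).
Qed.

Lemma class_adjacent i j : i != j -> ~~ P j i ->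
  (forall t, P i t -> P t j -> False) ->
  exists z, [/\ R x z, adj z i j & forall t, t != i -> t != j ->
    ~~ P t i -> ~~ P t j -> bef z j t].
Proof.
move=> nij nji nbet.
pose cls t := if t == i then 1 else if t == j then 2 else
  if P t i || P t j then 0 else 3.
have ci : cls i = 1 by rewrite /cls eqxx.
have cj : cls j = 2 by rewrite /cls eqxx [j == i]eq_sym (negbTE nij).
have cls3 t : cls t <= 3 by rewrite /cls; do ![case: ifP => //].
have [z hz] := reorder cls y; exists z; split.
- apply: class_of_bef => a b ab; rewrite hz (ord_bef_top ab) andbT orbC -leq_eqVlt.
  have [b3|] := eqVneq (cls b) 3; first by rewrite b3 cls3.
  case: (eqVneq b i) => [eb|nbi].
    subst b; rewrite ci /cls (negbTE (ord_neq ab)) ab /=.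
    by case: eqP => // e; subst a; rewrite ab in nji.
  case: (eqVneq b j) => [eb|nbj].
    by subst b; rewrite cj /cls (negbTE (ord_neq ab)) ab orbT; case: ifP.
  have -> : cls b = if P b i || P b j then 0 else 3.
    by rewrite /cls (negbTE nbi) (negbTE nbj).
  case: ifP => // hb _; rewrite /cls.
  case: eqP => [e|_].
    subst a; case/orP: hb => [/(ord_asym ab)//|hb]; by case: (nbet b).
  case: eqP => [e|_].
    by subst a; case/orP: hb => [hb|/(ord_asym ab)//]; rewrite (ord_trans ab hb) in nji.
  by case/orP: hb => /(ord_trans ab) ->; rewrite ?orbT.
- apply/adjP; split; first by rewrite hz ci cj.
  move=> t h h'; have tj := bef_neq h'.
  have ti : t != i by rewrite eq_sym (bef_neq h).
  by move: h h'; rewrite !hz ci cj /cls (negbTE ti) (negbTE tj); case: ifP.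
- by move=> t ti tj h h'; rewrite hz cj /cls (negbTE ti) (negbTE tj) (negbTE h) (negbTE h').
Qed.

Lemma cover_not_contracted i j z : P i j -> R x z -> adj z i j -> ~~ R z (sw z i j).
Proof.
move=> ij xz a; apply/negP => h.
by have := class_bef (Rtrans xz h) ij; rewrite bef_sw_adj // !eqxx.
Qed.

Lemma incomparable_contracted i j z : ~~ P i j -> R x z -> adj z i j -> R z (sw z i j).
Proof.
move=> ij xz a; apply: Rtrans (Rsym xz) _; apply: class_of_bef => s t st.
rewrite bef_sw_adj //; case: ifP => [/andP[/eqP es /eqP et]|_].
  by move: ij; rewrite -es -et st.
by case: ifP => // _; apply: class_bef.
Qed.

Definition cover_set : {set 'I_n * 'I_n} := [set e | ord_cover e.1 e.2].
Notation nbrs := [set Y in qverts R | qadj R (rclass R x) Y].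

(** The first swap from the top [y] towards an upper neighbour already leaves the class, so it
    reaches that neighbour; dually for the bottom [x]. The two values swapped form a cover
    relation. *)
Lemma qdeg_le_covers : qdeg R (rclass R x) <= #|cover_set|.
Proof.
have [xy hy] := topy; have [_ hx] := botx.
(* Increasing covers are swapped in [y], decreasing ones in [x]; the image of [psi] has to contain
   all neighbours. *)
pose psi (e : 'I_n * 'I_n) :=
  if e.1 < e.2 then rclass R (sw y e.1 e.2) else rclass R (sw x e.1 e.2).
apply: leq_trans (leq_imset_card psi cover_set); apply: subset_leq_card.
apply/subsetP => Y; rewrite inE => /andP[/imsetP[v _ ->]].
case/orP => /and4P[_ _ /andP[neq le] /forall_inP hcov]; rewrite rclass_eq in neq.
  have [yv tv] := top_exists v; have [vyv _] := tv.
  have yyv : wle y yv by apply: qle_top le tv xy.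
  have nyv : y != yv.
    by apply: contra neq => /eqP e; apply: Rtrans xy _; rewrite e; apply: Rsym.
  have [p [q [pq a qp]]] := wle_cover yyv nyv.
  have [ypq bet] := adjP _ _ _ a.
  have sle : wle (sw y p q) yv by apply: wle_sw_le.
  have nx : ~~ R x (sw y p q).
    apply/negP => /hy h; have : bef y q p.
      by apply: (wleP _ _ h) => //; case/adjP: (adj_sw a).
    exact: bef_asym.
  apply/imsetP; exists (p, q).
    rewrite inE /=; apply/ord_coverP; split.
      by rewrite /P ypq (wle_bef wle_bot_top).
    by move=> t /andP[_ h] /andP[_ h']; apply: (bet t).
  rewrite /psi /= pq; apply/eqP; rewrite rclass_eq.
  have := hcov _ (rclass_qverts (sw y p q)).
  rewrite /qlt !rclass_eq nx (@qle_wle _ _ y (sw y p q)) ?wle_sw //=.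
  rewrite (@qle_wle _ _ (sw y p q) yv) // andbT negbK; exact: Rsym.
have [xv tv] := bot_exists v; have [vxv _] := tv.
have xvx : wle xv x by apply: qle_bot le tv _.
have nxv : xv != x.
  by apply: contra neq => /eqP e; rewrite -e.
have [p [q [pq a qp]]] := wle_cover_down xvx nxv.
have [xqp bet] := adjP _ _ _ a.
have a' : adj (sw x q p) p q := adj_sw a.
have ex : sw (sw x q p) p q = x by rewrite [sw _ p q]swC swK.
have sle : wle xv (sw x q p).
  by apply: (@wle_sw_ge _ _ _ p q) => //; rewrite ex.
have lex : wle (sw x q p) x by rewrite -{2}ex; apply: wle_sw.
have nx : ~~ R (sw x q p) x.
  apply/negP => /Rsym /hx h; have : bef (sw x q p) q p by apply: (wleP _ _ h).
  by apply: bef_asym; case/adjP: a'.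
apply/imsetP; exists (q, p).
  rewrite inE /=; apply/ord_coverP; split.
    by rewrite /P xqp (wleP _ _ wle_bot_top).
  by move=> t /andP[h _] /andP[h' _]; apply: (bet t).
rewrite /psi /= ltnNge (ltnW pq) /=; apply/eqP; rewrite rclass_eq.
have := hcov _ (rclass_qverts (sw x q p)).
rewrite /qlt !rclass_eq nx (@qle_wle (sw x q p) _ (sw x q p) x) //=.
by rewrite (@qle_wle v (sw x q p) xv (sw x q p)) // !andbT negbK.
Qed.

(** Every cover relation is adjacent in some word of the class, and swapping it there crosses an
    edge of the quotient. Different covers lead to different neighbours. *)
Lemma covers_le_qdeg : #|cover_set| <= qdeg R (rclass R x).
Proof.
(* On cover relations the default [x] is never taken, by [class_adjacent]. *)
pose sel (e : 'I_n * 'I_n) := odflt x [pick z | R x z && adj z e.1 e.2].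
have selP e : e \in cover_set -> R x (sel e) /\ adj (sel e) e.1 e.2.
  rewrite inE => /ord_coverP[h1 h2]; rewrite /sel; case: pickP => [z /andP[]//|h].
  have [|z [xz a _]] := @class_adjacent e.1 e.2 (ord_neq h1) _ h2.
    by apply/negP => /(ord_asym h1).
  by have := h z; rewrite xz a.
pose phi (e : 'I_n * 'I_n) := rclass R (sw (sel e) e.1 e.2).
have phi_inj : {in cover_set &, injective phi}.
  move=> [p q] [p' q'] h h'; have [xa aa] := selP _ h; have [xb ab] := selP _ h'.
  move: h h' aa ab xa xb; rewrite !inE /phi /=.
  set a := sel _; set b := sel _.
  move=> /ord_coverP[h1 _] /ord_coverP[h1' _] aa ab xa xb /eqP; rewrite rclass_eq => eab.
  have na := cover_not_contracted h1 xa aa; have nb := cover_not_contracted h1' xb ab.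
  (* An increasing swap moves up in the quotient and a decreasing one down; a common target would be
     both above and below the class. *)
  have updown c d i j k l : P i j -> P k l -> R x c -> R x d -> adj c i j -> adj d k l ->
      i < j -> l < k -> R (sw c i j) (sw d k l) -> False.
    move=> ij kl xc xd ac ad lij lkl e; have /negP := cover_not_contracted ij xc ac.
    apply; apply: qle_anti.
      by apply: (@qle_wle _ _ c (sw c i j)) => //; apply: wle_sw.
    apply: (@qle_wle _ _ (sw d k l) d) => //; first exact: Rtrans (Rsym xc) xd.
    by rewrite -{2}(swK d k l) [sw (sw _ _ _) _ _]swC; apply: wle_sw => //; apply: adj_sw.
  case: (ltngtP p q) => [pq|qp|/val_inj e]; last by move: (ord_neq h1); rewrite e eqxx.
    case: (ltngtP p' q') => [pq'|qp'|/val_inj e]; last by move: (ord_neq h1'); rewrite e eqxx.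
      (* The meet [m] lies in the common target. If it did not invert [p] and [q], it would lie
         below [a], and convexity would contract the edge. So [sw b p' q'] inverts them while [b]
         does not, which leaves only the swapped pair. *)
      have [m mm] := meet_exists (sw b p' q') (sw a p q); have [mb [ma _]] := mm.
      have am : R (sw a p q) m.
        exact: (cong_meet congR) eab (is_meet_le (wle_refl _)) mm.
      have mqp : bef m q p.
        have pq_neq : p != q by rewrite ltn_neq.
        rewrite (befN _ pq_neq); apply/negP => mpq.
        have lma := wle_sw_ge ma aa pq mpq.
        have := cong_convex congR lma (wle_sw aa pq) (Rsym am).
        by move=> mRa; move/negP: na; apply; apply: Rsym; apply: Rtrans am mRa.
      have := (wleP _ _ mb) _ _ pq mqp; rewrite inv_sw //.
      case/orP => [/andP[/eqP-> /eqP->]//|].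
      by move=> /(bef_asym (class_bef xb h1)).
    by case: (updown a b p q p' q').
  case: (ltngtP p' q') => [pq'|qp'|/val_inj e]; last by move: (ord_neq h1'); rewrite e eqxx.
    by case: (updown b a p' q' p q) => //; apply: Rsym.
  have [m mm] := join_exists (sw b p' q') (sw a p q); have [bm [lam _]] := mm.
  have am : R (sw a p q) m.
    exact: (cong_join congR) eab (is_join_le (wle_refl _)) mm.
  have mqp : bef m q p.
    have pq_neq : p != q by rewrite eq_sym ltn_neq.
    rewrite (befN _ pq_neq); apply/negP => mpq.
    have ea : sw (sw a p q) q p = a by rewrite [sw _ q p]swC swK.
    have aa' := adj_sw aa.
    have : wle (sw (sw a p q) q p) m by apply: wle_sw_le.
    move/(cong_convex congR (wle_sw aa' qp))/(_ am); rewrite ea => /Rsym.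
    exact/negP.
  have := wle_bef bm qp mqp; rewrite bef_sw_adj //.
  case: ifP => // _; case: ifP => [/andP[/eqP-> /eqP->]//|_].
  by move/(bef_asym (class_bef xb h1)).
rewrite -(card_in_imset phi_inj); apply: subset_leq_card.
apply/subsetP => _ /imsetP[[p q] h ->]; have [xz az] := selP _ h.
move: h az; rewrite !inE rclass_qverts /= => /ord_coverP[h _] az.
have nz := cover_not_contracted h xz az.
have -> : rclass R x = rclass R (sel (p, q)) by apply/eqP; rewrite rclass_eq.
rewrite /qadj /phi /=; move: nz az; set z := sel _ => nz az.
case: (ltngtP p q) => [pq|qp|/val_inj e]; last by move: (ord_neq h); rewrite e eqxx.
  by rewrite qcover_sw.
apply/orP; right; have ez : z = sw (sw z p q) q p by rewrite [sw _ q p]swC swK.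
rewrite {2}ez; apply: qcover_sw => //; first exact: adj_sw.
by rewrite -ez; apply: contra nz; apply: Rsym.
Qed.

Lemma qdegE : qdeg R (rclass R x) = #|cover_set|.
Proof. by apply/eqP; rewrite eqn_leq qdeg_le_covers covers_le_qdeg. Qed.

End Class.
End Quotient.

(** If membership never changed between consecutive values, it would be constant. Consecutive values
    matter because an essential congruence keeps them comparable in every class. *)
Lemma crossing_consecutive n (S : {set 'I_n}) (i j : 'I_n) :
  i \in S -> j \notin S ->
  exists a b : 'I_n, b = a.+1 :> nat /\ (a \in S) != (b \in S).
Proof.
move=> iS jS.
have [/existsP[a /existsP[b /andP[/eqP ab neq]]]|H] :=
  boolP [exists a : 'I_n, exists b : 'I_n, (b == a.+1 :> nat) && ((a \in S) != (b \in S))].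
  by exists a, b.
have step m (k l : 'I_n) : l = k + m :> nat -> (k \in S) = (l \in S).
  elim: m l => [|m IH] l e; first by congr (_ \in S); apply: val_inj; rewrite /= e addn0.
  have lt : k + m < n by apply: ltn_trans (ltn_ord l); rewrite e addnS.
  rewrite (IH (Ordinal lt)) //; apply/eqP/negPn; apply: contra H => neq.
  by apply/existsP; exists (Ordinal lt); apply/existsP; exists l; rewrite neq e addnS /= eqxx.
have : (i \in S) = (j \in S).
  case: (leqP i j) => ij; first by apply: (step (j - i)); rewrite subnKC.
  by apply/esym; apply: (step (i - j)); rewrite subnKC // ltnW.
by rewrite iS (negbTE jS).
Qed.

(** * Connectedness and acyclicity of the cover graph *)

Section CoverGraph.
Variables (n : nat) (R : rel {perm 'I_n}).
Hypothesis congR : lattice_congruence R.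
Variables x y : {perm 'I_n}.
Hypothesis (topy : is_top R x y) (botx : is_bot R x x).
Implicit Types (u v w z m : {perm 'I_n}) (i j k p q r s t a b c : 'I_n).
Implicit Types (S V : {set 'I_n}).

Notation P := (ord_rel x y).
Notation cov := (ord_cover x y).

Definition inner_edges S : {set 'I_n * 'I_n} :=
  [set e in cover_set x y | (e.1 \in S) && (e.2 \in S)].

Lemma in_inner_edges S i j :
  ((i, j) \in inner_edges S) = [&& cov i j, i \in S & j \in S].
Proof. by rewrite !inE. Qed.

Lemma inner_edgesT : inner_edges [set: 'I_n] = cover_set x y.
Proof. by apply/setP => e; rewrite inE !in_setT !andbT. Qed.

Section Connected.
Hypothesis essR : essential R.

(** If incomparable, [a] and [b] would be adjacent in some word of the class; their swap is
    contracted, and with it the whole fence f(a,a+1,{}). *)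
Lemma consecutive_comparable a b : b = a.+1 :> nat -> P a b || P b a.
Proof.
move=> ab; apply/negPn/negP; rewrite negb_or => /andP[nab nba].
have lab : a < b by rewrite ab.
have [t h /(ord_trans h)|z [xz az _]] := class_adjacent congR topy botx (ltn_neq lab) nba.
  by rewrite (negbTE nab).
have Rz := incomparable_contracted congR topy botx nab xz az.
apply: (essR ab); split; first by rewrite /is_fence /fa /fb /fL /= lab sub0set.
move=> u w /fence_edgeP[]; rewrite /is_fence /fa /fb /fL /= ?lab ?sub0set //.
move=> au -> _; apply: (cong_same_fence congR lab az au _ Rz) => c; lia.
Qed.

(* A comparable pair separated by [S], chosen at minimal distance in [y], is a
   cover. *)
Lemma cover_across S i j : i \in S -> j \notin S ->
  exists p q, cov p q /\ (p \in S) != (q \in S).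
Proof.
move=> iS jS; have [a [b [ab neq]]] := crossing_consecutive iS jS.
have [p [q [pq neq']]] : exists p q, P p q /\ (p \in S) != (q \in S).
  by case/orP: (consecutive_comparable ab) => h; [exists a, b|exists b, a; rewrite eq_sym].
have [k] := ubnP ((y^-1)%g q - (y^-1)%g p).
elim: k p q pq neq' => // k IH p q pq neq' le.
have [/existsP[t /andP[pt tq]]|h] := boolP [exists t, P p t && P t q]; last first.
  exists p, q; split=> //; apply/ord_coverP; split=> // t pt tq.
  by case/existsP: h; exists t; rewrite pt.
have pty := ord_bef_top pt; have tqy := ord_bef_top tq.
have [e|h] := eqVneq (p \in S) (t \in S).
  apply: (IH t q) => //; first by rewrite -e.
  by move: pty tqy le; rewrite /bef; clear; lia.
by apply: (IH p t) => //; move: pty tqy le; rewrite /bef; clear; lia.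
Qed.

(** Adding to [S] the outer end of a cover that leaves it gains at least one inner edge, until [S]
    is everything. A singleton gives the bound n-1, a four-cycle the bound n. *)
Lemma cover_set_ge S : S != set0 -> n + #|inner_edges S| <= #|cover_set x y| + #|S|.
Proof.
have [k] := ubnP #|~: S|; elim: k S => // k IH S; rewrite ltnS => le /set0Pn[i iS].
have [->|nST] := eqVneq S setT.
  by rewrite inner_edgesT cardsT card_ord addnC.
have [j jS] : exists j, j \notin S.
  apply/existsP; apply: contraR nST => /existsPn h; apply/eqP/setP=> j.
  by rewrite inE; apply/negPn.
have [p [q [pq neq]]] := cover_across iS jS.
have [v vS [e eS]] : exists2 v, v \notin S &
    exists2 e, e \in inner_edges (v |: S) & e \notin inner_edges S.
  have [pS|pS] := boolP (p \in S).
    have qS : q \notin S by move: neq; rewrite pS; case: (q \in S).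
    by exists q => //; exists (p, q); rewrite in_inner_edges pq ?in_setU1 ?pS ?eqxx ?orbT //= (negbTE qS).
  have qS : q \in S by move: neq; rewrite (negbTE pS); case: (q \in S).
  by exists p => //; exists (p, q); rewrite in_inner_edges pq ?in_setU1 ?qS ?eqxx ?orbT //= (negbTE pS).
move=> enS; have card_v : #|v |: S| = #|S|.+1 by rewrite cardsU1 vS.
have sub : e |: inner_edges S \subset inner_edges (v |: S).
  apply/subsetP=> -[a' b']; rewrite in_setU1 => /orP[/eqP->//|].
  rewrite !in_inner_edges !in_setU1 => /and3P[-> -> ->]; by rewrite !orbT.
have := subset_leq_card sub; rewrite cardsU1 enS.
have := cardsC S; have := cardsC (v |: S); rewrite card_v.
have := IH (v |: S) _ (_ : v |: S != set0); rewrite card_v.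
move=> IH' c1 c2 c3.
have le' : #|~: (v |: S)| < k by move: c1 c2 le; clear; lia.
have ne : v |: S != set0 by apply/set0Pn; exists v; rewrite setU11.
by move: (IH' le' ne) c3; clear; lia.
Qed.

End Connected.

(* If the last element [s] of [V] in [y] has two lower covers in [V], no cover
   inside [V :\ s] joins the values below [s] to those above it, so the edges of
   [V :\ s] split into two smaller instances. *)
Lemma inner_edges_lt :
  (forall r r' s, cov r s -> cov r' s -> r < r' -> [/\ r < s, s < r' &
     forall p q, cov p q -> bef y p s -> bef y q s -> (p < s) = (q < s)]) ->
  forall V, V != set0 -> #|inner_edges V| < #|V|.
Proof.
move=> H V; have [k] := ubnP #|V|; elim: k V => // k IH V; rewrite ltnS => leV ne.
have [s sV slast] : exists2 s, s \in V & forall t, t \in V -> t != s -> bef y t s.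
  have [i iV] := set0Pn _ ne.
  have [s sV h] := arg_maxnP (fun t => (y^-1)%g t : nat) iV; exists s => // t tV ts.
  case/orP: (bef_total y ts) => // h'; have := h t tV; rewrite /bef in h' *.
  by move=> /= h2; move: h' h2; clear; lia.
pose V' := V :\ s; pose D := [set r in V' | cov r s].
have cardV : #|V| = #|V'|.+1 by rewrite (cardsD1 s V) sV.
(* As [s] is last in [y], the edges of [V] at [s] come from its lower covers, collected in [D]. *)
have edgesV : #|inner_edges V| <= #|inner_edges V'| + #|D|.
  have sub : inner_edges V \subset inner_edges V' :|: [set (r, s) | r in D].
    apply/subsetP=> -[p q]; rewrite in_setU !in_inner_edges /V' !in_setD1.
    move=> /and3P[pq pV qV]; rewrite pq pV qV !andbT /=.
    have /ord_coverP[hpq _] := pq; have yp := ord_bef_top hpq.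
    have [eq|nqs] := eqVneq q s.
      subst q; apply/orP; right; apply/imsetP; exists p => //.
      by rewrite !inE pV pq (bef_neq yp).
    have [ep|nps //] := eqVneq p s.
    by subst p; case: (bef_asym yp (slast q qV nqs)).
  apply: leq_trans (subset_leq_card sub) _; apply: leq_trans (leq_card_setU _ _) _.
  by rewrite leq_add2l leq_imset_card.
have [e0|ne'] := eqVneq V' set0.
  have : inner_edges V' = set0.
    by apply/setP => -[p q]; rewrite in_inner_edges e0 !in_set0 !andbF.
  have : D = set0 by apply/setP=> r; rewrite inE e0 in_set0.
  move=> eD eE; move: edgesV; rewrite eD eE !cards0 cardV; lia.
have ltV' : #|V'| < k by move: leV; rewrite cardV.
have := IH V' ltV' ne'; rewrite cardV => IHV'.
case: (leqP #|D| 1) => [D1|]; first by move: edgesV IHV' D1; clear; lia.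
move=> /card_gt1P[r0 [r1 [r0D r1D neqr]]].
have [r [r' [rD r'D rr']]] : exists r r', [/\ r \in D, r' \in D & r < r'].
  case: (ltngtP r0 r1) => [h|h|/val_inj e]; [by exists r0, r1|by exists r1, r0|].
  by rewrite e eqxx in neqr.
have Dcov t : t \in D -> cov t s by rewrite inE => /andP[].
have [rs sr' nostr] := H _ _ _ (Dcov _ rD) (Dcov _ r'D) rr'.
(* [H] puts [s] strictly between any two of its lower covers, so at most one is smaller and at most
   one is larger. *)
have D2 : #|D| <= 2.
  have sub : D \subset [set r; r'].
    apply/subsetP=> t tD; rewrite !inE.
    case: (ltngtP t s) => [ts|st|/val_inj e].
    - case: (ltngtP t r) => [h|h|/val_inj->]; last by rewrite eqxx.
        have [_ h' _] := H _ _ _ (Dcov _ tD) (Dcov _ rD) h; move: h' rs; clear; lia.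
      have [_ h' _] := H _ _ _ (Dcov _ rD) (Dcov _ tD) h; move: h' ts; clear; lia.
    - case: (ltngtP t r') => [h|h|/val_inj->]; last by rewrite eqxx orbT.
        have [h' _ _] := H _ _ _ (Dcov _ tD) (Dcov _ r'D) h; move: h' st; clear; lia.
      have [h' _ _] := H _ _ _ (Dcov _ r'D) (Dcov _ tD) h; move: h' sr'; clear; lia.
    - by move: tD; rewrite e !inE eqxx.
  by apply: leq_trans (subset_leq_card sub) _; rewrite cards2; case: (_ != _).
pose Vl := [set t in V' | t < s]; pose Vr := [set t in V' | s < t].
have rV' : r \in V' by move: rD; rewrite inE => /andP[].
have r'V' : r' \in V' by move: r'D; rewrite inE => /andP[].
have cardV' : #|Vl| + #|Vr| <= #|V'|.
  have dis : Vl :&: Vr = set0.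
    by apply/setP=> t; rewrite !inE; case: (ltngtP t s); rewrite ?andbF.
  rewrite -cardsUI dis cards0 addn0; apply: subset_leq_card.
  by apply/subsetP=> t; rewrite !inE => /orP[] /andP[].
have edgesV' : #|inner_edges V'| <= #|inner_edges Vl| + #|inner_edges Vr|.
  apply: leq_trans (leq_card_setU _ _); apply: subset_leq_card.
  apply/subsetP=> -[p q]; rewrite in_setU !in_inner_edges => /and3P[pq pV' qV'].
  have bs t : t \in V' -> bef y t s by rewrite in_setD1 => /andP[ts tV]; apply: slast.
  have := nostr _ _ pq (bs _ pV') (bs _ qV'); rewrite pq [p \in Vl]inE [q \in Vl]inE.
  rewrite [p \in Vr]inE [q \in Vr]inE pV' qV' /=.
  have := bef_neq (bs _ pV'); have := bef_neq (bs _ qV'); rewrite -!val_eqE /=.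
  by case: (ltngtP p s); case: (ltngtP q s).
have nl : Vl != set0 by apply/set0Pn; exists r; rewrite inE rV'.
have nr : Vr != set0 by apply/set0Pn; exists r'; rewrite inE r'V'.
have leVl : #|Vl| < k.
  by apply: leq_ltn_trans ltV'; apply: subset_leq_card; apply/subsetP=> t; rewrite inE => /andP[].
have leVr : #|Vr| < k.
  by apply: leq_ltn_trans ltV'; apply: subset_leq_card; apply/subsetP=> t; rewrite inE => /andP[].
(* At most (|Vl| - 1) + (|Vr| - 1) edges avoid [s] and at most two meet it, hence at most |V'| = |V|
   - 1 in total. *)
by move: (IH _ leVl nl) (IH _ leVr nr) edgesV edgesV' D2 cardV'; clear; lia.
Qed.

End CoverGraph.

(** * Simple arcs *)

Section Arcs.
Variables (n : nat) (R : rel {perm 'I_n}).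
Hypothesis congR : lattice_congruence R.
Implicit Types (u v w x y z m : {perm 'I_n}) (i j k p q r s t a b c d e : 'I_n).
Implicit Types (f g h : fence n).

Definition is_fence_edge f u : bool := adj u (fa f) (fb f) &&
  [forall c in oint (fa f) (fb f), (c \in fL f) == bef u c (fa f)].

(** The Boolean form of [inF] allows a shortest fence of F_R to be selected. *)
Definition inFb f : bool := is_fence f &&
  [forall u, is_fence_edge f u ==> R u (sw u (fa f) (fb f))].

Lemma is_fence_edgeP f u : is_fence f ->
  reflect (fence_edge f u (sw u (fa f) (fb f))) (is_fence_edge f u).
Proof.
move=> ff; apply: (iffP andP) => [[a /forall_inP h]|/(fence_edgeP _ _ ff)[a _ h]].
  by apply/fence_edgeP=> //; split=> // c cin; apply/eqP/h.
by split=> //; apply/forall_inP => c cin; apply/eqP/h.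
Qed.

Lemma inFP f : reflect (inF R f) (inFb f).
Proof.
apply: (iffP andP) => -[ff h]; split=> //.
  move=> u w uw; have [_ ew _] := proj1 (fence_edgeP u w ff) uw.
  by rewrite ew in uw *; apply: (implyP (forallP h u)); apply/is_fence_edgeP.
by apply/forallP=> u; apply/implyP => /(is_fence_edgeP _ ff); apply: h.
Qed.

Definition forcesb f g : bool := [&& fa f <= fa g, fa g < fb g, fb g <= fb f,
  (fa f, fb f) != (fa g, fb g) & fL g == fL f :&: oint (fa g) (fb g)].

Lemma forcesP f g : reflect (forces f g) (forcesb f g).
Proof.
apply: (iffP and5P) => [[h1 h2 h3 /eqP h4 /eqP h5]//|[h1 [h2 [h3 [/eqP h4 h5]]]]].
by rewrite h5.
Qed.

Lemma forces_size f g : forces f g -> fb g - fa g < fb f - fa f.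
Proof.
move=> [h1 [h2 [h3 [ne _]]]].
have : (fa f != fa g :> nat) || (fb f != fb g :> nat).
  by rewrite !val_eqE -negb_and; apply/negP => /andP[/eqP ea /eqP eb]; apply: ne; rewrite ea eb.
by move: h1 h2 h3; clear; lia.
Qed.

Lemma oint_sub a b c d : c <= a -> b <= d -> oint a b \subset oint c d.
Proof. by move=> ca bd; apply/subsetP => k; rewrite !inE; move: ca bd; clear; lia. Qed.

Lemma forces_trans f g h : forces f g -> forces g h -> forces f h.
Proof.
move=> fg gh; have sfg := forces_size fg; have sgh := forces_size gh.
have [h1 [h2 [h3 [_ h5]]]] := fg; have [g1 [g2 [g3 [_ g5]]]] := gh.
split; first exact: leq_trans h1 g1.
do 2![split=> //]; first exact: leq_trans g3 h3.
split; last by rewrite g5 h5 -setIA (setIidPr (oint_sub g1 g3)).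
by move=> [ea eb]; move: sfg sgh; rewrite ea eb; clear; lia.
Qed.

(** Going up in the forcing order strictly shortens the interval, so a shortest fence of F_R at or
    above [f] is maximal. *)
Lemma maximal_above f : inF R f ->
  exists g, in_reduced_arc_diagram R g /\ (g = f \/ forces f g).
Proof.
move=> fF; pose T g := inFb g && ((g == f) || forcesb f g).
have Tf : T f by rewrite /T eqxx andbT; apply/inFP.
have [g /andP[/inFP gF gf] gmin] := arg_minnP (fun g => fb g - fa g) Tf.
exists g; split; last by case/orP: gf => [/eqP|/forcesP]; auto.
split=> // h hf gh /inFP hF; have lt := forces_size gh.
have := gmin h; rewrite /T hF /= leqNgt lt => /(_ _)/negP; case=> //.
apply/orP; right; apply/forcesP.
by case/orP: gf => [/eqP <-//|/forcesP fg]; apply: forces_trans fg gh.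
Qed.

Lemma contracted_inF z p q : adj z p q -> p < q -> R z (sw z p q) ->
  inF R (p, q, [set c in oint p q | bef z c p]).
Proof.
move=> az pq Rz; set f := (_, _, _).
have ff : is_fence f.
  by rewrite /is_fence pq; apply/subsetP=> c; rewrite !inE => /andP[].
split=> // u w /(fence_edgeP _ _ ff)[/= au -> h].
apply: (cong_same_fence congR pq az au _ Rz) => c pc cq.
have := h c; rewrite /f /fa /fb /fL /= !inE pc cq /= => <- //.
Qed.

(* [l] tells whether the values of ]a,b[ stand to the left: f(a,b,]a,b[) if
   [l], f(a,b,{}) otherwise. *)
Definition simple_arc (l : bool) a b : Prop :=
  inF R (a, b, if l then oint a b else set0) /\ a.+1 < b.
Definition arc_side (l : bool) z a b p : Prop :=
  forall c, a < c -> c < b -> bef z c p = l.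

Definition nbr z p q := adj z p q || adj z q p.

(** Edges are undirected: if [q] stands before [p], the swapped word replaces [z], and all other
    values keep their side. *)
Lemma nbr_sw z p q : nbr z p q -> p < q ->
  exists z', [/\ adj z' p q, R z' (sw z' p q) <-> R z (sw z p q) &
    forall c, c != p -> c != q -> bef z' c p = bef z c p].
Proof.
case/orP=> a pq; first by exists z.
have a' : adj (sw z p q) p q by rewrite swC; apply: adj_sw.
exists (sw z p q); split=> //; first by rewrite swK; split; apply: cong_sym.
move=> c cp cq; rewrite swC bef_sw_adj //.
by rewrite (negbTE cp) (negbTE cq) /=.
Qed.

(** The arc forces the edge: all of ]a,b[ stands on side [l], so the fence of the arc is a
    restriction of that of the edge. *)
Lemma simple_contracted z p q l a b : nbr z p q -> p <= a -> b <= q ->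
  simple_arc l a b -> arc_side l z a b p -> R z (sw z p q).
Proof.
move=> nz pa bq [[_ abF] ab] side.
have lab : a < b by apply: ltn_trans ab.
have pq : p < q by apply: leq_trans bq; apply: leq_ltn_trans pa lab.
have [z' [a' <- side']] := nbr_sw nz pq.
apply: (contracted_forces congR a' pa lab bq) => v av pat.
apply: abF; apply/fence_edgeP; first by rewrite /is_fence /fa /fb /fL /= lab; case: (l); rewrite ?sub0set ?subxx.
split=> // c; rewrite /fa /fb /fL /= inE => /andP[ac cb].
rewrite -pat // side' -?val_eqE /=; try by move: pa bq ac cb; clear; lia.
by rewrite side //; case: l {side}; rewrite inE ?ac ?cb.
Qed.

Section Simple.
Hypothesis simpleR : reduced_arc_diagram_simple R.

(** A converse of [simple_contracted]: the fence of the edge lies at or below a maximal fence of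
    F_R, which is simple, and its all-or-nothing pattern gives the side [l]. *)
Lemma contracted_simple z p q : nbr z p q -> p < q -> R z (sw z p q) ->
  exists l a b, [/\ p <= a, b <= q, simple_arc l a b & arc_side l z a b p].
Proof.
move=> nz pq; have [z' [a' <- side']] := nbr_sw nz pq => Rz.
have fF := contracted_inF a' pq Rz; have [g [gmax fg]] := maximal_above fF.
have [g2 gS] := simpleR gmax.
set f := (_, _, _) in fF fg.
have fsub : fL f \subset oint (fa f) (fb f) by apply/subsetP=> c; rewrite !inE => /andP[].
have [pa bq eL] : [/\ p <= fa g, fb g <= q & fL g = fL f :&: oint (fa g) (fb g)].
  case: fg => [->|[h1 [_ [h3 [_ h5]]]]] //; split=> //.
  by rewrite (setIidPl fsub).
have cpq c : fa g < c -> c < fb g -> (c != p) * (c != q).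
  by move=> ac cb; split; rewrite -val_eqE /=; move: pa bq ac cb; clear; lia.
have inL c : fa g < c -> c < fb g -> (c \in fL g) = bef z c p.
  move=> ac cb; have [cp cq] := cpq c ac cb.
  rewrite eL inE /f /fL /= !inE side' // ac cb /= andbT.
  by rewrite (_ : p < c) 1?(_ : c < q) //; move: pa bq ac cb; clear; lia.
have [gF _] := gmax; have ab1 : (fa g).+1 < fb g by move: g2; clear; lia.
have eg : g = (fa g, fb g, fL g) by rewrite /fa /fb /fL; case: g {gmax fg g2 gS pa bq eL cpq inL gF ab1} => [[]].
case: gS => e.
  exists false, (fa g), (fb g); split=> //; first by split=> //; rewrite -e -eg.
  by move=> c ac cb; rewrite -inL // e inE.
exists true, (fa g), (fb g); split=> //; first by split=> //; rewrite -e -eg.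
by move=> c ac cb; rewrite -inL // e inE ac cb.
Qed.

End Simple.

Section Class.
Variables x y : {perm 'I_n}.
Hypothesis (topy : is_top R x y) (botx : is_bot R x x).
Notation P := (ord_rel x y).
Notation cov := (ord_cover x y).

Lemma cover_no_arc z p q l a b : P p q || P q p -> R x z -> nbr z p q ->
  p <= a -> b <= q -> simple_arc l a b -> arc_side l z a b p -> False.
Proof.
move=> pq xz nz pa bq ab side; have Rz := simple_contracted nz pa bq ab side.
have notR i j : P i j -> nbr z i j -> R z (sw z i j) -> False.
  move=> ij /orP[az|az]; first by apply/negP; exact: (cover_not_contracted congR topy botx ij xz az).
  by move=> _; case/adjP: az => /(bef_asym (class_bef topy botx xz ij)).
case/orP: pq => h; first exact: notR nz Rz.
by apply: (notR q p) => //; [rewrite /nbr orbC|rewrite swC].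
Qed.

(** Nothing lies strictly between [r1] or [r2] and [s], so a linear extension may list the values
    above neither [r1] nor [r2], then [r1], [r2], [s], then everything else. *)
Lemma two_covers r1 r2 s : r1 != r2 -> cov r1 s -> cov r2 s ->
  exists z, [/\ R x z, adj z r1 r2, adj z r2 s &
    forall t, t != r1 -> t != r2 -> t != s -> bef z t r1 = ~~ (P r1 t || P r2 t)].
Proof.
move=> n12 /ord_coverP[h1 b1] /ord_coverP[h2 b2].
have n21 : ~~ P r2 r1 by apply/negP => h; apply: b2 h h1.
have n12' : ~~ P r1 r2 by apply/negP => h; apply: b1 h h2.
have s1 : s != r1 by rewrite eq_sym (ord_neq h1).
have s2 : s != r2 by rewrite eq_sym (ord_neq h2).
pose cls t := if t == r1 then 1 else if t == r2 then 2 else if t == s then 3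
  else if P r1 t || P r2 t then 4 else 0.
have c1 : cls r1 = 1 by rewrite /cls eqxx.
have c2 : cls r2 = 2 by rewrite /cls eqxx eq_sym (negbTE n12).
have c3 : cls s = 3 by rewrite /cls eqxx (negbTE s1) (negbTE s2).
have cN t : t != r1 -> t != r2 -> t != s -> cls t = if P r1 t || P r2 t then 4 else 0.
  by move=> t1 t2 t3; rewrite /cls (negbTE t1) (negbTE t2) (negbTE t3).
have cle t : cls t <= 4 by rewrite /cls; do ![case: ifP => //].
have [z hz] := reorder cls y; exists z.
have out t : t != r1 -> t != r2 -> t != s ->
   (bef z t r1 = ~~ (P r1 t || P r2 t)) * (bef z r1 t = (P r1 t || P r2 t)) *
   (bef z t r2 = ~~ (P r1 t || P r2 t)) * (bef z r2 t = (P r1 t || P r2 t)) *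
   (bef z t s = ~~ (P r1 t || P r2 t)).
  by move=> t1 t2 t3; rewrite !hz c1 c2 c3 cN //; case: ifP.
split.
- apply: (class_of_bef congR topy botx) => i j ij.
  rewrite hz (ord_bef_top ij) andbT orbC -leq_eqVlt.
  have [ej|j1] := eqVneq j r1.
    subst j; rewrite c1; have [ei|i1] := eqVneq i r1; first by rewrite ei c1.
    rewrite cN //; last by apply/negP => /eqP e; subst i; case: (ord_asym ij h1).
      case: ifP => // /orP[|h]; first by move=> /(ord_asym ij).
      by rewrite (ord_trans h ij) in n21.
    by apply/negP => /eqP e; subst i; rewrite ij in n21.
  have [ej|j2] := eqVneq j r2.
    subst j; rewrite c2; have [ei|i1] := eqVneq i r1; first by rewrite ei c1.
    have [ei|i2] := eqVneq i r2; first by rewrite ei c2.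
    rewrite cN //; last by apply/negP => /eqP e; subst i; case: (ord_asym ij h2).
    case: ifP => // /orP[h|]; last by move=> /(ord_asym ij).
    by rewrite (ord_trans h ij) in n12'.
  have [ej|j3] := eqVneq j s.
    subst j; rewrite c3; have [ei|i1] := eqVneq i r1; first by rewrite ei c1.
    have [ei|i2] := eqVneq i r2; first by rewrite ei c2.
    have [ei|i3] := eqVneq i s; first by rewrite ei c3.
    rewrite cN //; case: ifP => // /orP[h|h]; [by case: (b1 i)|by case: (b2 i)].
  rewrite (cN j) //; case: ifP => [//|hj].
  move/negbT: hj; rewrite negb_or => /andP[hj1 hj2].
  rewrite cN.
  + case: ifP => // /orP[h|h].
      by rewrite (ord_trans h ij) in hj1.
    by rewrite (ord_trans h ij) in hj2.
  + by apply: contra hj1 => /eqP <-.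
  + by apply: contra hj2 => /eqP <-.
  + by apply: contra hj1 => /eqP ei; apply: ord_trans h1 _; rewrite -ei.
- apply/adjP; split=> [|t h h']; first by rewrite hz c1 c2.
  have t1 : t != r1 by rewrite eq_sym (bef_neq h).
  have t2 := bef_neq h'.
  have [et|t3] := eqVneq t s; first by move: h'; rewrite et hz c3 c2.
  by move: h h'; rewrite !out //; case: (_ || _).
- apply/adjP; split=> [|t h h']; first by rewrite hz c2 c3.
  have t2 : t != r2 by rewrite eq_sym (bef_neq h).
  have t3 := bef_neq h'.
  have [et|t1] := eqVneq t r1; first by move: h; rewrite et hz c1 c2.
  by move: h h'; rewrite !out //; case: (_ || _).
- by move=> t t1 t2 t3; rewrite out.
Qed.

End Class.
End Arcs.

(** * Edge counts of the cover graph, and the resulting degrees *)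

Section Degrees.
Variables (n : nat) (R : rel {perm 'I_n}).
Hypothesis congR : lattice_congruence R.
Hypothesis essR : essential R.
Implicit Types (u v w z : {perm 'I_n}) (i j k p q r s t a b c d e l m : 'I_n).
Implicit Types (f g h : fence n).

Section Class.
Variables x y : {perm 'I_n}.
Hypothesis (topy : is_top R x y) (botx : is_bot R x x).
Notation P := (ord_rel x y).
Notation cov := (ord_cover x y).

Section Simple.
Hypothesis simpleR : reduced_arc_diagram_simple R.

(** The words [zA] and [zB] contain r r' s and r' r s. A simple arc contracts the swap of the
    incomparable [r] and [r']. Were [s] outside ]a,b[, the arc would fit between [s] and [r'] or
    between [r] and [s] and contract a cover. Since [s] stands right of [r], the side is settled. *)
Lemma two_covers_arc r r' s : cov r s -> cov r' s -> r < r' ->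
  exists a b, [/\ r <= a, b <= r', a < s < b, simple_arc R false a b &
    forall c, a < c -> c < b -> c != s -> P r c || P r' c].
Proof.
move=> cr cr' rr'; have [/ord_coverP[hr br] /ord_coverP[hr' br']] := (cr, cr').
have nrr' : r != r' by rewrite ltn_neq.
have [zA [xA a1 a2 outA]] := two_covers congR topy botx nrr' cr cr'.
have nr'r : r' != r by rewrite eq_sym.
have [zB [xB b1 b2 outB]] := two_covers congR topy botx nr'r cr' cr.
have nP : ~~ P r r' by apply/negP => h; apply: br h hr'.
have RA := incomparable_contracted congR topy botx nP xA a1.
have nA : nbr zA r r' by rewrite /nbr a1.
have [l [a [b [ra br'' ab side]]]] := contracted_simple congR simpleR nA rr' RA.
have sA : bef zA s r = false.
  apply/negP => h; have [h1 _] := adjP _ _ _ a1; have [h2 _] := adjP _ _ _ a2.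
  exact: bef_asym h (bef_trans h1 h2).
have inr c : a < c -> c < b -> (c != r) * (c != r').
  by move=> ac cb; split; rewrite -val_eqE /=; move: ra br'' ac cb; clear; lia.
have side' c : a < c -> c < b -> c != s -> ~~ (P r c || P r' c) = l.
  by move=> ac cb cs; rewrite -outA ?side ?(inr _ ac cb).
have as_ : a < s.
  rewrite ltnNge; apply/negP => sa; apply: (cover_no_arc congR topy botx _ xA _ sa br'' ab).
  - by rewrite hr' orbT.
  - by rewrite /nbr a2 orbT.
  move=> c ac cb; have [c1 c2] := inr c ac cb.
  have cs : c != s by rewrite -val_eqE /=; move: sa ac; clear; lia.
  by rewrite -(adj_out a2 c2 cs) -(adj_out a1 c1 c2) side.
have sb : s < b.
  rewrite ltnNge; apply/negP => bs; apply: (cover_no_arc congR topy botx _ xB _ ra bs ab).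
  - by rewrite hr.
  - by rewrite /nbr b2.
  move=> c ac cb; have [c1 c2] := inr c ac cb.
  have cs : c != s by rewrite -val_eqE /=; move: bs cb; clear; lia.
  by rewrite -(adj_out b1 c2 c1) outB // orbC side'.
have el : l = false by rewrite -(side s as_ sb).
rewrite el in ab side'; exists a, b; split=> //; first by rewrite as_.
by move=> c ac cb cs; apply/negbNE; rewrite side'.
Qed.

(* A value c of ]a,b[ incomparable to [s] and closest to it would yield an arc
   between s and c; since the values in between are above [s], that arc would
   contract the cover [r' s] or [r s]. *)
Lemma two_covers_min r r' s a b : cov r s -> cov r' s -> r < r' ->
  r <= a -> b <= r' -> a < s < b ->
  (forall c, a < c -> c < b -> c != s -> P r c || P r' c) ->
  forall c, a < c -> c < b -> c != s -> P s c.
Proof.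
move=> cr cr' rr' ra br'' /andP[as_ sb] up.
have [/ord_coverP[hr br] /ord_coverP[hr' br']] := (cr, cr').
have nrr' : r != r' by rewrite ltn_neq.
have [zA [xA a1 a2 _]] := two_covers congR topy botx nrr' cr cr'.
have nr'r : r' != r by rewrite eq_sym.
have [zB [xB b1 b2 _]] := two_covers congR topy botx nr'r cr' cr.
have ncs c : a < c -> c < b -> c != s -> ~~ P c s.
  move=> ac cb cs; apply/negP => h.
  by case/orP: (up c ac cb cs) => h'; [apply: br h' h|apply: br' h' h].
have arc_of c : a < c -> c < b -> c != s -> ~~ P s c ->
    exists z, [/\ R x z, adj z s c & R z (sw z s c)].
  move=> ac cb cs nsc; have sc : s != c by rewrite eq_sym.
  have [t h /(ord_trans h)|z [xz az _]] := class_adjacent congR topy botx sc (ncs c ac cb cs).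
    by rewrite (negbTE nsc).
  by exists z; split=> //; apply: (incomparable_contracted congR topy botx).
(* A simple arc has an inner value, and this value decides its side. *)
have inner (l : bool) a' b' : simple_arc R l a' b' -> exists2 c : 'I_n, a' < c & c < b'.
  by move=> [_ h]; exists (Ordinal (ltn_trans h (ltn_ord b'))) => /=.
have above z c : R x z -> P s c -> bef z c s = false.
  by move=> xz sc; apply/negP => /(bef_asym (class_bef topy botx xz sc)).
have gt c : s < c -> c < b -> P s c.
  have [k] := ubnP (c - s); elim: k c => // k IH c le sc cb.
  apply/negPn/negP => nsc; have ac := ltn_trans as_ sc.
  have cs : c != s by rewrite eq_sym ltn_neq.
  have [z [xz az Rz]] := arc_of c ac cb cs nsc.
  have nz : nbr z s c by rewrite /nbr az.
  have [l [a' [b' [sa' bc ab' side]]]] := contracted_simple congR simpleR nz sc Rz.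
  have IH' d : a' < d -> d < b' -> P s d.
    by move=> ad db; apply: IH; move: sa' bc ad db le cb; clear; lia.
  have [d ad db] := inner _ _ _ ab'.
  (* Inner values of the arc are nearer to [s] than [c], hence above [s] by induction and to its
     right in every word of the class. *)
  have el : l = false by rewrite -(side d ad db) above // IH'.
  have b'r' : b' <= r' by move: bc cb br''; clear; lia.
  apply: (cover_no_arc congR topy botx _ xA _ sa' b'r' ab').
  - by rewrite hr' orbT.
  - by rewrite /nbr a2 orbT.
  by move=> e ae eb; rewrite el above // IH'.
(* The mirror image: the cover that would be contracted is now [r s], adjacent in [zB]. *)
have lt c : a < c -> c < s -> P s c.
  have [k] := ubnP (s - c); elim: k c => // k IH c le ac cs'.
  apply/negPn/negP => nsc; have cb := ltn_trans cs' sb.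
  have cs : c != s by rewrite ltn_neq.
  have [z [xz az Rz]] := arc_of c ac cb cs nsc.
  have nz : nbr z c s by rewrite /nbr az orbT.
  rewrite swC in Rz.
  have [l [a' [b' [ca' bs ab' side]]]] := contracted_simple congR simpleR nz cs' Rz.
  have IH' d : a' < d -> d < b' -> P s d.
    by move=> ad db; apply: IH; move: ca' bs ad db le ac; clear; lia.
  have [d ad db] := inner _ _ _ ab'.
  have el : l = false.
    rewrite -(side d ad db).
    have ds : d != s by rewrite -val_eqE /=; move: bs db; clear; lia.
    have dc : d != c by rewrite -val_eqE /=; move: ca' ad; clear; lia.
    by rewrite -(adj_out az ds dc) above // IH'.
  have ra' : r <= a' by move: ca' ac ra; clear; lia.
  apply: (cover_no_arc congR topy botx _ xB _ ra' bs ab').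
  - by rewrite hr.
  - by rewrite /nbr b2.
  move=> e ae eb.
  have es : e != s by rewrite -val_eqE /=; move: bs eb; clear; lia.
  have er : e != r by rewrite -val_eqE /=; move: ra' ae; clear; lia.
  by rewrite (adj_out b2 er es) el above // IH'.
move=> c ac cb cs; case: (ltngtP c s) => [h|h|/val_inj e]; [exact: lt|exact: gt|].
by rewrite e eqxx in cs.
Qed.

(** Every value of ]a,b[ is [s] or above it in [P], so [p] and [q], preceding [s], lie outside
    ]a,b[. If they were on different sides of [s], then in a word with [p], [q] adjacent and ]a,b[
    to their right the arc f(a,b,{}) would contract their cover. *)
Lemma two_covers_straddle r r' s : cov r s -> cov r' s -> r < r' ->
  [/\ r < s, s < r' & forall p q, cov p q -> bef y p s -> bef y q s -> (p < s) = (q < s)].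
Proof.
move=> cr cr' rr'; have [a [b [ra br' asb ab up]]] := two_covers_arc cr cr' rr'.
have smin := two_covers_min cr cr' rr' ra br' asb up; have /andP[as_ sb] := asb.
split; [exact: leq_ltn_trans as_|exact: leq_trans br'|] => p q pq ps qs.
have [hpq nopq] := ord_coverP _ _ _ _ pq.
have nP c t : a < c -> c < b -> bef y t s -> ~~ P c t.
  move=> ac cb ts; apply/negP => ct.
  have [e|cs] := eqVneq c s; first by subst c; case: (bef_asym ts (ord_bef_top ct)).
  by case: (bef_asym ts (ord_bef_top (ord_trans (smin c ac cb cs) ct))).
have notin t : bef y t s -> (t <= a) || (b <= t).
  move=> ts; rewrite leqNgt [b <= t]leqNgt -negb_and; apply/negP => /andP[ta tb].
  by case: (bef_asym ts (ord_bef_top (smin t ta tb (bef_neq ts)))).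
have nqp : ~~ P q p by apply/negP => /(ord_asym hpq).
have [z [xz az out]] := class_adjacent congR topy botx (bef_neq (ord_bef_top hpq)) nqp nopq.
have after c : a < c -> c < b -> (bef z c p = false) * (bef z c q = false).
  move=> ac cb; have cp : c != p.
    by have := notin p ps; rewrite -val_eqE /=; move: ac cb; clear; lia.
  have cq : c != q.
    by have := notin q qs; rewrite -val_eqE /=; move: ac cb; clear; lia.
  have := out c cp cq (nP c p ac cb ps) (nP c q ac cb qs) => qc.
  have h : bef z c q = false by apply/negP => /(bef_asym qc).
  by rewrite (adj_out az cp cq) h.
have no (lo hi : 'I_n) : lo <= a -> b <= hi -> P lo hi || P hi lo -> nbr z lo hi ->
   (forall c, a < c -> c < b -> bef z c lo = false) -> False.
  by move=> la bh pp nz side; apply: (cover_no_arc congR topy botx pp xz nz la bh ab side).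
apply/idP/idP => h; apply: contraT; rewrite -leqNgt => h'.
  have pa : p <= a by have := notin p ps; move: h sb; clear; lia.
  have bq : b <= q by have := notin q qs; move: h' as_; clear; lia.
  case: (no p q pa bq); rewrite ?hpq /nbr ?az //.
  by move=> c ac cb; rewrite after.
have qa : q <= a by have := notin q qs; move: h sb; clear; lia.
have bp : b <= p by have := notin p ps; move: h' as_; clear; lia.
case: (no q p qa bp); rewrite ?hpq /nbr ?az ?orbT //.
by move=> c ac cb; rewrite after.
Qed.

Lemma cover_set_lt_simple : 0 < n -> #|cover_set x y| < n.
Proof.
move=> n0; rewrite -inner_edgesT -[X in _ < X]card_ord -cardsT.
apply: inner_edges_lt; first exact: two_covers_straddle.
by apply/set0Pn; exists (Ordinal n0).
Qed.

End Simple.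

(** In a chain no element has two lower covers, so the premise of [inner_edges_lt] holds
    vacuously. *)
Lemma cover_set_lt_total : 0 < n -> (forall i j, i < j -> P i j) ->
  #|cover_set x y| < n.
Proof.
move=> n0 tot; rewrite -inner_edgesT -[X in _ < X]card_ord -cardsT.
apply: inner_edges_lt; last by apply/set0Pn; exists (Ordinal n0).
by move=> r r' s /ord_coverP[_ h] /ord_coverP[h' _] /tot /h; case.
Qed.

Lemma predn_le_cover_set : 0 < n -> n.-1 <= #|cover_set x y|.
Proof.
move=> n0; have ne : [set Ordinal n0] != set0 by apply/set0Pn; exists (Ordinal n0); rewrite inE.
have := cover_set_ge congR topy botx essR ne.
by rewrite cards1; clear; lia.
Qed.

Lemma cover_of_edge z i j : R x z -> adj z i j -> ~~ R z (sw z i j) -> cov i j.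
Proof.
move=> xz az nR; apply/ord_coverP; split.
  by apply: contraR nR => nP; apply: (incomparable_contracted congR topy botx).
have [_ h] := adjP _ _ _ az.
by move=> t it tj; apply: (h t); apply: (class_bef topy botx xz).
Qed.

(* The four edges form a cycle l - a - m - b of the cover graph, which is
   connected and hence has at least [n] edges. *)
Lemma cover_set_ge_cycle l a b m u : a < l -> l < b -> a < m -> m < b -> l != m ->
  R x u -> R u (sw u a b) -> adj u l a -> adj u a b -> adj u b m ->
  ~~ R u (sw u a l) -> ~~ R u (sw u m b) ->
  let w := sw u a b in ~~ R w (sw w l b) -> ~~ R w (sw w a m) ->
  n <= #|cover_set x y|.
Proof.
move=> al lb am mb lm xu Ruw ala aab abm n1 n2 w n3 n4.
have la_ : l != a by rewrite eq_sym ltn_neq.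
have lb_ := ltn_neq lb; have ma_ : m != a by rewrite eq_sym ltn_neq.
have mb_ := ltn_neq mb; have ab_ : a != b := ltn_neq (ltn_trans al lb).
have xw : R x w := cong_trans congR xu Ruw.
have ba_ : b != a by rewrite eq_sym.
have bl_ : b != l by rewrite eq_sym.
have al_ : a != l by rewrite eq_sym.
have am_ : a != m by rewrite eq_sym.
have bm_ : b != m by rewrite eq_sym.
(* After the swap the four values stand in the order l b a m. *)
have awlb : adj w l b.
  rewrite adj_pos /w /sw invMg tpermV !permM tpermR tpermD //.
  by rewrite -adj_pos.
have awam : adj w a m.
  rewrite adj_pos /w /sw invMg tpermV !permM tpermL tpermD //.
  by rewrite -adj_pos.
have c1 : cov l a by apply: cover_of_edge xu ala _; rewrite swC.
have c2 : cov b m by apply: cover_of_edge xu abm _; rewrite swC.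
have c3 : cov l b by apply: cover_of_edge xw awlb n3.
have c4 : cov a m by apply: cover_of_edge xw awam n4.
pose S := [set l; a; b; m].
have neS : S != set0 by apply/set0Pn; exists l; rewrite !inE eqxx.
have cardS : #|S| <= 4.
  rewrite /S !(leq_trans (leq_card_setU _ _)) //.
  by rewrite cards1 addn1 ltnS (leq_trans (leq_card_setU _ _)) // cards1 addn1 ltnS cards2;
     case: (_ != _).
have sub : [set (l, a); (b, m); (l, b); (a, m)] \subset inner_edges x y S.
  by apply/subsetP=> e; rewrite !inE -!orbA => /or4P[] /eqP-> /=; rewrite ?c1 ?c2 ?c3 ?c4 ?eqxx ?orbT.
have := subset_leq_card sub.
have -> : #|[set (l, a); (b, m); (l, b); (a, m)]| = 4.
  rewrite -!setUA !cardsU1 cards1 !inE !xpair_eqE.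
  by rewrite (negbTE lb_) (negbTE la_) (negbTE ab_) (negbTE ba_) (negbTE bl_) (negbTE mb_) ?andbF /=.
move=> card_edges; have := cover_set_ge congR topy botx essR neS => ge.
rewrite -(leq_add2r 4); apply: leq_trans (leq_trans ge _); rewrite leq_add2l //.
Qed.

End Class.

Lemma qdeg_cover_set v : exists x y, [/\ is_top R x y, is_bot R x x,
  R v x & qdeg R (rclass R v) = #|cover_set x y|].
Proof.
have [x [vx hx]] := bot_exists congR v; have [y topy] := top_exists congR x.
exists x, y.
have botx : is_bot R x x.
  split; first exact: cong_refl.
  by move=> w xw; apply: hx; apply: cong_trans vx xw.
split=> //; rewrite -(qdegE congR topy botx); congr qdeg.
by apply/eqP; rewrite rclass_eq.
Qed.

Lemma predn_le_qdeg v : 0 < n -> n.-1 <= qdeg R (rclass R v).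
Proof.
move=> n0; have [x [y [topy botx _ ->]]] := qdeg_cover_set v.
exact: predn_le_cover_set.
Qed.

Lemma qdeg_simple v : 0 < n -> reduced_arc_diagram_simple R ->
  qdeg R (rclass R v) = n.-1.
Proof.
move=> n0 simpleR; apply/eqP; rewrite eqn_leq predn_le_qdeg // andbT.
have [x [y [topy botx _ ->]]] := qdeg_cover_set v.
by rewrite -ltnS prednK //; apply: cover_set_lt_simple.
Qed.

(** The identity is the bottom of its class, so the comparable values i and i+1 can only be
    increasing in [P], which is therefore the natural chain. *)
Lemma qdeg_id : 0 < n -> qdeg R (rclass R 1%g) = n.-1.
Proof.
move=> n0; apply/eqP; rewrite eqn_leq predn_le_qdeg // andbT.
have [x [y [topy botx Rx ->]]] := qdeg_cover_set 1%g.
have b1 i j : bef 1%g i j = (i < j) by rewrite /bef invg1 !perm1.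
have ex : x = 1%g.
  apply: wle_anti; first by have [_ h] := botx; apply: h; apply: (cong_sym congR).
  by apply/wleP => i j ij; rewrite b1 ltnNge (ltnW ij).
rewrite -ltnS prednK //; apply: cover_set_lt_total => // i j.
have [k] := ubnP (j - i); elim: k i j => // k IH i j le ij.
have lt : i.+1 < n by apply: leq_ltn_trans ij (ltn_ord j).
have step : ord_rel x y i (Ordinal lt).
  have := consecutive_comparable congR topy botx essR (erefl : Ordinal lt = i.+1 :> nat).
  by case/orP=> // /andP[]; rewrite ex b1 /= ltnNge leqnSn.
have [e|ne] := eqVneq (i.+1 : nat) j; first by rewrite (_ : j = Ordinal lt) //; apply: val_inj.
by apply: ord_trans step (IH _ _ _ _); move: le ij ne => /=; clear; lia.
Qed.

(** A contraction would put into F_R the fence of (p,q) with the restricted pattern, which is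
    strictly above [f] in the forcing order. *)
Lemma maximal_sub_edge f p q z : in_reduced_arc_diagram R f ->
  fa f <= p -> p < q -> q <= fb f -> q - p < fb f - fa f ->
  nbr z p q -> (forall c, p < c -> c < q -> bef z c p = (c \in fL f)) ->
  ~~ R z (sw z p q).
Proof.
move=> [_ fmax] ap pq qb lt nz pat.
have [z' [a' iff side]] := nbr_sw congR nz pq; apply/negP => /iff Rz.
have gF := contracted_inF congR a' pq Rz.
have [gf _] := gF; apply: fmax gf _ gF; do 3![split=> //]; split.
  by move=> [ea eb]; move: lt; rewrite ea eb ltnn.
apply/setP => c; rewrite !inE /fa /fb /=; case pc: (p < c); case cq: (c < q); rewrite ?andbF //=.
have cp : c != p by rewrite eq_sym ltn_neq.
by rewrite (side _ cp (ltn_neq cq)) pat // andbT.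
Qed.

Lemma regular_simple : 0 < n -> Q_regular R -> reduced_arc_diagram_simple R.
Proof.
move=> n0 [k regk] f fmax.
(* The class of the identity determines the common degree. *)
have ek : k = n.-1 by rewrite -(regk _ (rclass_qverts R 1%g)) qdeg_id.
have [fF _] := fmax; have [ff _] := fF; have /andP[ab Lsub] := ff.
set a := fa f in ab Lsub *; set b := fb f in ab Lsub *; set L := fL f in Lsub *.
have ef : f = (a, b, L) by rewrite /a /b /L /fa /fb /fL; case: (f) => [[]].
split.
  (* If b = a+1, then ]a,b[ is empty and [f] is a fence excluded by essentiality. *)
  rewrite ltn_subRL addn1 ltn_neqAle ab andbT; apply/negP => /eqP e.
  have L0 : L = set0.
    apply/setP=> c; rewrite in_set0; apply/negP => /(subsetP Lsub).
    by rewrite inE => /andP[ac]; rewrite -e ltnS leqNgt ac.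
  by apply: (essR (esym e)); rewrite -L0 -ef.
have [L0|/set0Pn[l lL]] := eqVneq L set0; first by left.
right; apply/eqP; rewrite eqEsubset [_ \subset _]Lsub /=.
apply/negPn/negP => /subsetPn[m mab mL].
have lab := subsetP Lsub _ lL; move: lab mab; rewrite !inE => /andP[al lb] /andP[am mb].
have lm : l != m by apply: contraNneq mL => <-.
have la_ : l != a by rewrite eq_sym ltn_neq.
have lb_ := ltn_neq lb; have ma_ : m != a by rewrite eq_sym ltn_neq.
have mb_ := ltn_neq mb; have ba_ : b != a by rewrite eq_sym (ltn_neq ab).
have [al_ bl_] : a != l /\ b != l by rewrite ![_ == l]eq_sym.
have [am_ bm_] : a != m /\ b != m by rewrite ![_ == m]eq_sym.
(* [u] reads the rest of [L], then l a b m, then the remaining values: an edge of [f] with [l] and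
   [m] next to the swapped pair. *)
pose cls i := if i == a then 3 else if i == b then 4 else if i == l then 2
  else if i == m then 5 else if i \in L then 1 else 6.
have ca : cls a = 3 by rewrite /cls eqxx.
have cb : cls b = 4 by rewrite /cls eqxx (negbTE ba_).
have cl : cls l = 2 by rewrite /cls eqxx (negbTE la_) (negbTE lb_).
have cm : cls m = 5 by rewrite /cls eqxx (negbTE ma_) (negbTE mb_) [m == l]eq_sym (negbTE lm).
have c_other i : i != a -> i != b -> i != l -> i != m -> cls i = if i \in L then 1 else 6.
  by move=> h1 h2 h3 h4; rewrite /cls (negbTE h1) (negbTE h2) (negbTE h3) (negbTE h4).
have [u hu] := reorder cls 1%g.
(* Only blocks 1 and 6 may hold several values, so blocks 2 to 5 are consecutive single letters. *)
have cls_inj s t : cls s = cls t -> 1 < cls s < 6 -> s = t.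
  rewrite /cls; do 4?[case: (s =P _) => [->|_]]; do 4?[case: (t =P _) => [->|_]] => //;
  by do ?case: ifP.
have adj_cls i j : cls j = (cls i).+1 -> 1 < cls i < 5 -> adj u i j.
  move=> cj hk; apply/adjP; split; first by rewrite hu cj ltnSn.
  move=> t h h'; have [ti tj] : cls t != cls i /\ cls t != cls j.
    split; apply/eqP => e.
      have eti : t = i by apply: (cls_inj _ _ e); rewrite e; move: hk; clear; lia.
      by move: h; rewrite eti bef_irr.
    have etj : t = j by apply: (cls_inj _ _ e); rewrite e cj; move: hk; clear; lia.
    by move: h'; rewrite etj bef_irr.
  by move: h h' ti tj; rewrite !hu cj; clear; lia.
have ala : adj u l a by apply: adj_cls; rewrite ?cl ?ca.
have aab : adj u a b by apply: adj_cls; rewrite ?ca ?cb.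
have abm : adj u b m by apply: adj_cls; rewrite ?cb ?cm.
have patu c : c != a -> c != b -> [/\ bef u c a = (c \in L), bef u c b = (c \in L),
    c != l -> bef u c l = (c \in L) & c != m -> bef u c m = (c \in L)].
  move=> h1 h2; have [el|h3] := eqVneq c l.
    by rewrite el lL !hu cl ca cb cm; split.
  have [em|h4] := eqVneq c m.
    by rewrite em (negbTE mL) !hu cl ca cb cm; split.
  by rewrite !hu c_other // ca cb cl cm; case: ifP.
have Ruw : R u (sw u a b).
  case: fF => _ h; apply: h; apply/fence_edgeP=> //; split=> // c.
  rewrite inE => /andP[ac cb']; have [|h _ _ _] := patu c _ (ltn_neq cb').
    by rewrite eq_sym ltn_neq.
  by rewrite h.
have patw c d : c != a -> c != b -> d != a -> d != b -> bef (sw u a b) c d = bef u c d.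
  by move=> h1 h2 h3 h4; rewrite bef_sw_adj // (negbTE h1) (negbTE h2).
have [x [y [topy botx Rux degu]]] := qdeg_cover_set u.
have Rxu : R x u by apply: (cong_sym congR).
have degn : n <= qdeg R (rclass R u).
  (* The four edges join pairs properly nested in (a,b) with the pattern of [L], so by maximality of
     [f] none of them is contracted. *)
  have edge z p q := @maximal_sub_edge f p q z fmax.
  rewrite degu; apply: (cover_set_ge_cycle topy botx al lb am mb lm Rxu Ruw ala aab abm).
  - apply: edge => //; [exact: ltnW|by move: al lb; rewrite /a /b; clear; lia|by rewrite /nbr ala orbT|].
    move=> c ac cl'; have [|h _ _ _] := patu c _ (ltn_neq (ltn_trans cl' lb)).
      by rewrite eq_sym ltn_neq.
    by rewrite h.
  - apply: edge => //; [exact: ltnW|by move: am mb; rewrite /a /b; clear; lia|by rewrite /nbr abm orbT|].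
    move=> c mc cb'; have [|_ _ _ h] := patu c _ (ltn_neq cb').
      by rewrite eq_sym ltn_neq // (ltn_trans am).
    by rewrite h // eq_sym ltn_neq.
  - apply: edge => //; [exact: ltnW|by move: al lb; rewrite /a /b; clear; lia| |].
      by rewrite /nbr adj_pos /sw invMg tpermV !permM tpermR tpermD // -adj_pos ala.
    move=> c lc cb'; have c1 : c != a by rewrite eq_sym ltn_neq // (ltn_trans al).
    have c2 := ltn_neq cb'; have [_ _ h _] := patu c c1 c2.
    by rewrite patw // h // eq_sym ltn_neq.
  - apply: edge => //; [exact: ltnW|by move: am mb; rewrite /a /b; clear; lia| |].
      by rewrite /nbr adj_pos /sw invMg tpermV !permM tpermL tpermD // -adj_pos abm.
    move=> c ac cm'; have c2 : c != b by rewrite ltn_neq // (ltn_trans cm').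
    have c1 : c != a by rewrite eq_sym ltn_neq.
    have [h _ _ _] := patu c c1 c2.
    by rewrite bef_sw_adj // (negbTE c1) (negbTE c2) h.
move: degn; rewrite (regk _ (rclass_qverts R u)) ek; move: n0; clear; lia.
Qed.

End Degrees.

Theorem mainTheorem13 (n : nat) (R : rel {perm 'I_n}) :
  0 < n -> lattice_congruence R -> essential R ->
  (Q_regular R <-> reduced_arc_diagram_simple R) /\
  (reduced_arc_diagram_simple R -> Q_kregular R n.-1).
Proof.
move=> n0 congR essR.
have kreg : reduced_arc_diagram_simple R -> Q_kregular R n.-1.
  by move=> simpleR _ /imsetP[v _ ->]; apply: qdeg_simple.
split=> //; split; first exact: regular_simple.
by move=> /kreg; exists n.-1.
Qed.
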